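(* Let $G$ be a finite simple graph. Then $$\lambda_1\left(\operatorname{curl}^*\operatorname{curl}\right)+\lambda_2\left(\operatorname{curl}^*\operatorname{curl}\right)\le D_1^\top(G)+D_2^\top(G),$$ where $\operatorname{curl}$ is the graph curl of $G$, $\lambda_i(\operatorname{curl}^*\operatorname{curl})$ denotes the $i$-th largest eigenvalue (counted with multiplicity) of $\operatorname{curl}^*\operatorname{curl}$, and $D_i^\top(G)$ is the number of vertices of $G$ lying in at least $i$ triangles.
   Context: Let $G$ be a finite simple graph with vertex set $V(G)$, edge set $E(G)$, and set of triangles $T(G)$, where a triangle is a set of three pairwise adjacent vertices. $L^2_\wedge(E(G))$ is the real vector space of functions $X:V(G)\times V(G)\to\mathbb R$ with $X(u,v)=-X(v,u)$ if $\{u,v\}\in E(G)$ and $X(u,v)=0$ otherwise. $L^2_\wedge(T(G))$ is the real vector space of functions $\Phi:V(G)^3\to\mathbb R$ such that $\Phi(u,v,w)=0$ if $\{u,v,w\}\notin T(G)$, and $\Phi$ is alternating (changes sign under transposition of two arguments) on triangles. These spaces carry the inner products $\langle X,Y\rangle=\sum X(u,v)Y(u,v)$, summed once over each edge $\{u,v\}$, and $\langle\Phi,\Psi\rangle=\sum\Phi(u,v,w)\Psi(u,v,w)$, summed once over each triangle $\{u,v,w\}$. The graph curl $\operatorname{curl}:L^2_\wedge(E(G))\to L^2_\wedge(T(G))$ is $(\operatorname{curl}X)(u,v,w)=X(u,v)+X(v,w)+X(w,u)$ if $\{u,v,w\}\in T(G)$ and $0$ otherwise. Its adjoint $\operatorname{curl}^*$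 is given by $(\operatorname{curl}^*\Phi)(u,v)=\sum_{w\in V(G)}\Phi(u,v,w)$ if $\{u,v\}\in E(G)$ and $0$ otherwise. The operator $\operatorname{curl}^*\operatorname{curl}$ on $L^2_\wedge(E(G))$ is self-adjoint and positive semidefinite. If this space has dimension less than $i$, $\lambda_i$ is taken to be $0$. For $v\in V(G)$, $\deg_G^{(2)}(v)$ is the number of triangles of $G$ containing $v$, and $D_i^\top(G)=|\{v\in V(G):\deg_G^{(2)}(v)\ge i\}|$ for $i\ge1$. *)

(* Defs.v *)
From HB Require Import structures.
From mathcomp Require Import all_boot all_order all_algebra.
From mathcomp Require Import polyrcf.
From mathcomp Require Import reals.

Set Implicit Arguments.
Unset Strict Implicit.
Unset Printing Implicit Defensive.

Import Order.TTheory GRing.Theory Num.Theory passmx.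
Local Open Scope ring_scope.

(* A finite simple graph is a symmetric irreflexive relation e on a finType; *)
(* symmetry and irreflexivity are only assumed where they are needed.        *)

Section Triangles.
Variables (V : finType) (e : rel V).

Definition triangles : {set {set V}} :=
  [set t : {set V} | (#|t| == 3)
     && [forall u in t, forall v in t, (u != v) ==> e u v]].

Definition deg2 (v : V) : nat := #|[set t in triangles | v \in t]|.

Definition Dtop (i : nat) : nat := #|[set v : V | (i <= deg2 v)%N]|.

Lemma triangles_edge (u v w : V) :
  [set u; v; w] \in triangles -> e u v /\ e v u.
Proof.
rewrite inE => /andP[/eqP t3 /forall_inP tr].
have uv : u != v.
  apply/eqP => uv; move: t3; rewrite uv setUid => t3.
  by have := cards2 v w; rewrite t3; case: (v != w).
have ut : u \in [set u; v; w] by rewrite !inE eqxx.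
have vt : v \in [set u; v; w] by rewrite !inE eqxx orbT.
split; first by have /forall_inP/(_ v vt)/implyP := tr u ut; apply.
by have /forall_inP/(_ u ut)/implyP := tr v vt; apply; rewrite eq_sym.
Qed.

Lemma set3_swapl (u v w : V) : [set v; u; w] = [set u; v; w].
Proof. by rewrite (setUC [set v]). Qed.

Lemma set3_swapr (u v w : V) : [set u; w; v] = [set u; v; w].
Proof. by rewrite setUAC. Qed.

Lemma set3_swapo (u v w : V) : [set w; v; u] = [set u; v; w].
Proof. by rewrite set3_swapl set3_swapr set3_swapl. Qed.

Lemma set3_rot (u v w : V) : [set v; w; u] = [set u; v; w].
Proof. by rewrite setUC setUA. Qed.

End Triangles.

Section Flows.
Variables (R : realType) (V : finType) (e : rel V).

(* All functions V x V -> R and V^3 -> R, as vector spaces over R. *)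
Notation fun2 := {ffun V * V -> R^o}.
Notation fun3 := {ffun V * V * V -> R^o}.

(* The flow spaces are carved out as kernels of linear maps measuring the    *)
(* failure of the defining conditions; edge_flowP and tri_flowP give the     *)
(* conditions themselves.                                                    *)
Definition edge_defect (X : fun2) : fun2 :=
  [ffun p => if e p.1 p.2 then X (p.1, p.2) + X (p.2, p.1) else X (p.1, p.2)].

Fact edge_defect_linear : linear edge_defect.
Proof.
move=> a X Y; apply/ffunP => -[u v]; rewrite !ffunE /=.
by case: ifP => // _; rewrite !scalerDr addrACA.
Qed.
HB.instance Definition _ :=
  GRing.isLinear.Build R fun2 fun2 _ edge_defect edge_defect_linear.

Definition L2E : {vspace fun2} := lker (linfun edge_defect).

Lemma edge_flowP (X : fun2) :
  reflect (forall u v, if e u v then X (u, v) = - X (v, u) else X (u, v) = 0)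
          (X \in L2E).
Proof.
rewrite memv_ker lfunE; apply: (iffP eqP) => [/ffunP X0 u v|X0].
  have := X0 (u, v); rewrite !ffunE /=; case: ifP => // _ /eqP.
  by rewrite addr_eq0 => /eqP.
apply/ffunP => -[u v]; rewrite !ffunE /=.
by have := X0 u v; case: ifP => // _ ->; rewrite addNr.
Qed.

(* s is the transposition of arguments whose sign rule is tested. *)
Definition tri_defect (s : V * V * V -> V * V * V) (Phi : fun3) : fun3 :=
  [ffun t => if [set t.1.1; t.1.2; t.2] \in triangles e
             then Phi t + Phi (s t) else Phi t].

Fact tri_defect_linear s : linear (tri_defect s).
Proof.
move=> a X Y; apply/ffunP => t; rewrite !ffunE /=.
by case: ifP => // _; rewrite !scalerDr addrACA.
Qed.
HB.instance Definition _ s :=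
  GRing.isLinear.Build R fun3 fun3 _ (tri_defect s) (tri_defect_linear s).

Definition L2T : {vspace fun3} :=
  (lker (linfun (tri_defect (fun t => (t.1.2, t.1.1, t.2))))
   :&: lker (linfun (tri_defect (fun t => (t.1.1, t.2, t.1.2))))
   :&: lker (linfun (tri_defect (fun t => (t.2, t.1.2, t.1.1)))))%VS.

Lemma tri_flowP (Phi : fun3) :
  reflect (forall u v w, if [set u; v; w] \in triangles e
           then [/\ Phi (v, u, w) = - Phi (u, v, w),
                    Phi (u, w, v) = - Phi (u, v, w)
                  & Phi (w, v, u) = - Phi (u, v, w)]
           else Phi (u, v, w) = 0)
          (Phi \in L2T).
Proof.
rewrite !memv_cap !memv_ker !lfunE /=; apply: (iffP idP).
  move=> /andP[/andP[/eqP/ffunP P1 /eqP/ffunP P2] /eqP/ffunP P3] u v w.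
  have := P3 (u, v, w); have := P2 (u, v, w); have := P1 (u, v, w).
  rewrite !ffunE /=; case: ifP => // _ H1 H2 H3.
  by split; apply/eqP; rewrite -addr_eq0 addrC; apply/eqP.
move=> P; apply/andP; split; first (apply/andP; split).
all: apply/eqP/ffunP => -[[u v] w]; rewrite !ffunE /=.
all: by have := P u v w; case: ifP => // _ [H1 H2 H3]; rewrite ?H1 ?H2 ?H3 subrr.
Qed.

Notation edge_flow := (subvs_of L2E).
Notation tri_flow := (subvs_of L2T).

Definition curl_fun (X : fun2) : fun3 :=
  [ffun t => let: (u, v, w) := t in
     if [set u; v; w] \in triangles e
     then X (u, v) + X (v, w) + X (w, u) else 0].

Definition curl_adj_fun (Phi : fun3) : fun2 :=
  [ffun p => let: (u, v) := p in
     if e u v then \sum_(w : V) Phi (u, v, w) else 0].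

Lemma curl_fun_in (X : edge_flow) : curl_fun (vsval X) \in L2T.
Proof.
have /edge_flowP anti := subvsP X; move: (vsval X) anti => {}X anti.
have asym a b c : [set a; b; c] \in triangles e -> X (a, b) = - X (b, a).
  by move=> /triangles_edge[eab _]; have := anti a b; rewrite eab.
apply/tri_flowP => u v w; rewrite !ffunE.
rewrite (set3_swapl u v w) (set3_swapr u v w) (set3_swapo u v w).
case: ifP => t; rewrite t //.
have uv := asym _ _ _ t.
have vw : X (v, w) = - X (w, v) by apply: (asym v w u); rewrite set3_rot t.
have wu : X (w, u) = - X (u, w).
  by apply: (asym w u v); rewrite (set3_rot v w u) set3_rot t.
rewrite uv vw wu !opprD !opprK; split.
- by rewrite addrAC.
- by rewrite addrC addrA addrAC.
- by congr (_ + _); rewrite addrC.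
Qed.

Lemma curl_adj_fun_in (Phi : tri_flow) : curl_adj_fun (vsval Phi) \in L2E.
Proof.
have /tri_flowP alt := subvsP Phi; move: (vsval Phi) alt => {}Phi alt.
have sw u v w : Phi (u, v, w) = - Phi (v, u, w).
  have := alt u v w; have := alt v u w; rewrite set3_swapl.
  by case: ifP => [_ [-> _ _] //|_ -> ->]; rewrite oppr0.
have z u v w : ~~ e u v -> Phi (u, v, w) = 0.
  move=> nuv; have := alt u v w; case: ifP => // /triangles_edge[euv _].
  by rewrite euv in nuv.
apply/edge_flowP => u v; rewrite !ffunE; case: ifP => euv; rewrite euv //.
have -> : \sum_w Phi (u, v, w) = - \sum_w Phi (v, u, w).
  by rewrite -sumrN; apply: eq_bigr => w _; apply: sw.
case: ifP => // /negbT nvu.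
by rewrite big1 // => w _; apply: z.
Qed.

Definition curl (X : edge_flow) : tri_flow := Subvs (curl_fun_in X).

Definition curl_adj (Phi : tri_flow) : edge_flow := Subvs (curl_adj_fun_in Phi).

Fact curl_linear : linear curl.
Proof.
move=> a X Y; apply/val_inj/ffunP => -[[u v] w].
rewrite /= !ffunE.
case: ifP => _; last by rewrite scaler0 addr0.
by rewrite !scalerDr [in RHS]addrACA; congr (_ + _); rewrite addrACA.
Qed.
HB.instance Definition _ :=
  GRing.isLinear.Build R edge_flow tri_flow _ curl curl_linear.

Fact curl_adj_linear : linear curl_adj.
Proof.
move=> a X Y; apply/val_inj/ffunP => -[u v].
rewrite /= !ffunE.
case: ifP => _; last by rewrite scaler0 addr0.
rewrite scaler_sumr -big_split; apply: eq_bigr => w _.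
by rewrite !ffunE.
Qed.
HB.instance Definition _ :=
  GRing.isLinear.Build R tri_flow edge_flow _ curl_adj curl_adj_linear.

Definition curl_adj_curl : 'End(edge_flow) := (linfun curl_adj \o linfun curl)%VF.

Lemma curl_adj_curlE (X : edge_flow) : curl_adj_curl X = curl_adj (curl X).
Proof. by rewrite comp_lfunE !lfunE. Qed.

(* Every edge is counted twice, every triangle six times. *)
Definition edge_dot (X Y : edge_flow) : R :=
  2^-1 * \sum_(u : V) \sum_(v : V) vsval X (u, v) * vsval Y (u, v).

Definition tri_dot (Phi Psi : tri_flow) : R :=
  6^-1 * \sum_(u : V) \sum_(v : V) \sum_(w : V)
           vsval Phi (u, v, w) * vsval Psi (u, v, w).

Lemma curl_adjP (X : edge_flow) (Phi : tri_flow) :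
  tri_dot (curl X) Phi = edge_dot X (curl_adj Phi).
Proof.
rewrite /tri_dot /edge_dot /=.
have /edge_flowP anti := subvsP X; have /tri_flowP alt := subvsP Phi.
move: (vsval X) (vsval Phi) anti alt => {}X {}Phi anti alt.
pose S := \sum_(u : V) \sum_(v : V) \sum_(w : V) X (u, v) * Phi (u, v, w).
have rot u v w : Phi (u, v, w) = Phi (v, w, u).
  have := alt u v w; have := alt v w u; have := alt v u w.
  rewrite (set3_swapl u v w) (set3_rot u v w).
  by case: ifP => [_ [-> -> _]|_ _ -> ->].
have -> : \sum_u \sum_v \sum_w curl_fun X (u, v, w) * Phi (u, v, w)
          = S + S + S.
  transitivity (S
     + \sum_u \sum_v \sum_w X (v, w) * Phi (u, v, w)
     + \sum_u \sum_v \sum_w X (w, u) * Phi (u, v, w)).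
    rewrite /S -!big_split; apply: eq_bigr => u _.
    rewrite -!big_split; apply: eq_bigr => v _.
    rewrite -!big_split; apply: eq_bigr => w _ /=; rewrite ffunE.
    have := alt u v w; case: ifP => [_ _|_ ->]; first by rewrite !mulrDl.
    by rewrite !mulr0 !addr0.
  congr (_ + _ + _).
    rewrite exchange_big /=; apply: eq_bigr => v _.
    rewrite exchange_big /=; apply: eq_bigr => w _.
    by apply: eq_bigr => u _; rewrite rot.
  transitivity (\sum_u \sum_w \sum_v X (w, u) * Phi (u, v, w)).
    by apply: eq_bigr => u _; rewrite exchange_big.
  rewrite exchange_big; apply: eq_bigr => w _; apply: eq_bigr => u _.
  by apply: eq_bigr => v _; rewrite (rot w).
have -> : \sum_u \sum_v X (u, v) * curl_adj_fun Phi (u, v) = S.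
  apply: eq_bigr => u _; apply: eq_bigr => v _; rewrite ffunE.
  have := anti u v; case: ifP => [_ _|_ ->]; first by rewrite mulr_sumr.
  by rewrite mul0r big1 // => w _; rewrite mul0r.
have -> : S + S + S = 3 * S by rewrite mulr_natl !mulrS mulr0n addr0 addrA.
rewrite mulrA; congr (_ * _).
have -> : (6 : R) = 3 * 2 by rewrite -natrM.
by rewrite invfM mulrC mulrA divff ?mul1r // pnatr_eq0.
Qed.

End Flows.

Section Spectrum.
Variables (R : realType) (vT : vectType R).
Implicit Type f : 'End(vT).

Definition lchar_poly f : {poly R} :=
  char_poly (mxof (vbasis {:vT}) (vbasis {:vT}) f).

(* Decreasing list of all real eigenvalues, each repeated according to its   *)
(* multiplicity as a root of the characteristic polynomial.                  *)
Definition eigenvalues f : seq R :=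
  sort (fun x y => y <= x)
    (flatten [seq nseq (mup x (lchar_poly f)) x | x <- rootsR (lchar_poly f)]).

(* i-th largest eigenvalue, for i >= 1; it is 0 if there is no such one. *)
Definition lambda (i : nat) f : R := (eigenvalues f)`_i.-1.

Lemma lchar_poly_neq0 f : lchar_poly f != 0.
Proof. by rewrite -size_poly_gt0 size_char_poly. Qed.

Lemma leigenvalueE f a : leigenvalue f a = root (lchar_poly f) a.
Proof.
rewrite -eigenvalue_root_char /leigenvalue /eigenvalue.
by rewrite (leigenspaceE (vbasisP _)) vsof_eq0 // vbasisP.
Qed.

Lemma count_eigenvalues f a :
  count_mem a (eigenvalues f) = mup a (lchar_poly f).
Proof.
set p := lchar_poly f.
rewrite /eigenvalues count_sort count_flatten -map_comp.
have cE x : count_mem a (nseq (mup x p) x) = ((x == a) * mup a p)%N.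
  by rewrite count_nseq /=; case: eqP => [->|].
rewrite (eq_map cE) sumnE big_map -big_distrl /=.
have -> : (\sum_(x <- rootsR p) (x == a) = (a \in rootsR p))%N.
  by rewrite -count_uniq_mem ?uniq_roots // -sum1_count [RHS]big_mkcond;
    apply: eq_bigr => x _ /=; case: (x == a).
have := roots_on_rootsR (lchar_poly_neq0 f) a; rewrite /= => <-.
by case: (boolP (root p a)) => [|/mupNroot ->]; rewrite ?mul1n ?muln0.
Qed.

End Spectrum.

(* Main.v *)
(* Call C the set of vertices in at least two triangles, h = #|C|, n the
   number of vertices in at least one triangle. Always lambda_1 <= n, so only
   the case c := lambda_2 > h matters. The triangles not contained in C
   ("pendant" ones) number at most n - h, and all triangles inside C are
   dominated by the complete complex on C, whose form is h |X|^2 - |div X|^2.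
   Completing squares, |curl X|^2 - c |X|^2 is bounded by a multiple of
   M_c(z) - (c - h) |z|^2, where z is the restriction of curl X to the pendant
   triangles and M_c is an explicit positive form whose trace is the number of
   pendant triangles. The span of two eigenvectors is thus mapped injectively
   to a plane on which M_c >= (lambda_2 - h) |z|^2. As M_c is affine in
   1 / (c - 2), some vector z also satisfies
   M_{lambda_2}(z) >= (lambda_1 - h) |z|^2, and two orthogonal vectors then give
   (lambda_1 - h) + (lambda_2 - h) <= tr M_{lambda_2} <= n - h. *)
Require Import Defs.
From mathcomp Require Import all_boot all_order all_algebra.
From mathcomp Require Import reals ring lra zify.
Set Implicit Arguments.
Unset Strict Implicit.
Unset Printing Implicit Defensive.
Import Order.TTheory GRing.Theory Num.Theory passmx.
Local Open Scope ring_scope.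

(** * Eigenvectors of self-adjoint endomorphisms *)

Lemma char_poly_conj (F : fieldType) n (P A B : 'M[F]_n) :
  P \in unitmx -> P *m A = B *m P -> char_poly A = char_poly B.
Proof.
move=> Pu PA; pose Q := map_mx polyC P.
have Q0 : \det Q != 0.
  by rewrite det_map_mx polyC_eq0 -unitfE -unitmxE.
apply: (mulfI Q0); rewrite [RHS]mulrC -!det_mulmx; congr (\det _).
rewrite /char_poly_mx mulmxBr mulmxBl scalar_mxC; congr (_ - _).
by rewrite -!map_mxM PA.
Qed.

(** In a basis whose first row is proportional to [v], [A] becomes block triangular with corner [a],
    so [char_poly A] is ['X - a%:P] times the characteristic polynomial of the action on the
    quotient by [v]. A multiple root leaves an eigenvector in that quotient, and its lift is an
    eigenvector up to a multiple of [v]. *)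
Lemma mup_char_poly_gt1 (F : fieldType) n (A : 'M[F]_n) a (v : 'rV_n) :
  v != 0 -> v *m A = a *: v -> (1 < mup a (char_poly A))%N ->
  exists w k, (forall c, w != c *: v) /\ w *m A = a *: w + k *: v.
Proof.
case: n A v => [|n] A v v0 vA mA; first by rewrite [v]thinmx0 eqxx in v0.
pose P : 'M_(1 + n) := row_ebase v.
have Pu : P \in unitmx by apply: row_ebase_unit.
pose r := usubmx P.
have [d vr] : exists d, v = d *: r.
  exists (col_ebase v 0 0); rewrite -{1}(mulmx_ebase v) rank_rV v0.
  rewrite [col_ebase v]mx11_scalar -mulmxA mul_scalar_mx; congr (_ *: _).
    by rewrite [RHS]mxE.
  have -> : r = row_mx 1%:M 0 *m P.
    by rewrite -{1}(vsubmxK P) mul_row_col mul1mx mul0mx addr0.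
  congr (_ *m _); apply/rowP => j; rewrite !mxE.
  by case: (splitP (j : 'I_(1 + n))) => k jk; rewrite !mxE jk ?ord1.
have d0 : d != 0 by apply: contraNneq v0 => d0; rewrite vr d0 scale0r.
have rA : r *m A = a *: r.
  apply: (scalerI d0); rewrite scalemxAl -vr vA.
  by rewrite scalerA mulrC -scalerA -vr.
pose B : 'M_(1 + n) := P *m A *m invmx P.
have BP : P *m A = B *m P by rewrite mulmxKV.
have uB : usubmx B = row_mx a%:M 0.
  rewrite /B -!mul_usub_mx rA -scalemxAl mul_usub_mx mulmxV //.
  rewrite (@scalar_mx_block _ 1 n) block_mxEv col_mxKu scale_row_mx scaler0.
  by rewrite scale_scalar_mx mulr1.
have Bul : ulsubmx B = a%:M by rewrite /ulsubmx uB row_mxKl.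
have Bur : ursubmx B = 0 by rewrite /ursubmx uB row_mxKr.
have cB : char_poly A = ('X - a%:P) * char_poly (drsubmx B).
  rewrite (char_poly_conj Pu BP) /char_poly /char_poly_mx -{1}(submxK B).
  rewrite map_block_mx Bul Bur map_mx0 (@scalar_mx_block _ 1 n).
  rewrite opp_block_mx add_block_mx oppr0 addr0 add0r det_lblock.
  by rewrite map_scalar_mx -raddfB /= det_scalar1.
have [u uE u0] : exists2 u : 'rV_n, u *m drsubmx B = a *: u & u != 0.
  apply/eigenvalueP; rewrite eigenvalue_root_char -dvdp_XsubCl.
  move: mA; rewrite mup_geq ?monic_neq0 ?char_poly_monic // cB expr2.
  by rewrite dvdp_mul2l // polyXsubC_eq0.
exists (row_mx 0 u *m P), ((u *m dlsubmx B) 0 0 / d); split=> [c|].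
  apply: contraNneq u0 => wv.
  have : row_mx 0 u = (c * d) *: usubmx (1%:M : 'M[F]_(1 + n)).
    by rewrite -(mulmxV Pu) -mul_usub_mx scalemxAl -scalerA -vr -wv mulmxK.
  rewrite (@scalar_mx_block _ 1 n) block_mxEv col_mxKu scale_row_mx scaler0.
  by case/eq_row_mx => _ ->.
rewrite -mulmxA BP mulmxA -{1}(submxK B) mul_row_block !mul0mx !add0r uE.
have -> : row_mx (u *m dlsubmx B) (a *: u)
     = a *: row_mx 0 u + row_mx (u *m dlsubmx B) 0.
  by rewrite scale_row_mx add_row_mx scaler0 add0r addr0.
rewrite mulmxDl scalemxAl; congr (_ + _).
rewrite -{1}(vsubmxK P) mul_row_col mul0mx addr0 {1}[_ *m dlsubmx _]mx11_scalar.
by rewrite mul_scalar_mx vr scalerA divfK.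
Qed.

Section SelfAdjoint.
Variables (R : realType) (vT : vectType R) (f : 'End(vT)) (d : vT -> vT -> R).

Lemma eigenvalues_eigenvector a :
  a \in eigenvalues f -> exists2 x, x != 0 & f x = a *: x.
Proof.
rewrite -has_pred1 has_count count_eigenvalues => ma.
have : leigenvalue f a.
  rewrite leigenvalueE; apply: contraLR ma => /mupNroot ->.
  by rewrite ltnn.
rewrite /leigenvalue -vpick0 => x0; exists (vpick (leigenspace f a)) => //.
have := memv_pick (leigenspace f a).
by rewrite /leigenspace memv_ker !lfun_simp subr_eq0 => /eqP.
Qed.

Hypothesis d_linear : forall k x y z, d (k *: x + y) z = k * d x z + d y z.
Hypothesis d_sym : forall x y, d x y = d y x.
Hypothesis d_gt0 : forall x, x != 0 -> 0 < d x x.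
Hypothesis f_adj : forall x y, d (f x) y = d x (f y).

Lemma inner0l y : d 0 y = 0.
Proof. by have := d_linear 1 0 0 y; rewrite scaler0 addr0 => H; lra. Qed.

Lemma innerZl k x y : d (k *: x) y = k * d x y.
Proof. by rewrite -[k *: x]addr0 d_linear inner0l addr0. Qed.

Lemma innerDl x y z : d (x + y) z = d x z + d y z.
Proof. by rewrite -[x]scale1r d_linear mul1r scale1r. Qed.

(** Algebraic multiplicity yields geometric multiplicity without diagonalizing [f]: pairing
    [f w = a *: w + k *: x] with [x] gives [k * d x x = 0] by self-adjointness, so the Jordan term
    vanishes. It remains to orthogonalize [w] against [x]. *)
Lemma mup_lchar_poly_gt1 a : (1 < mup a (lchar_poly f))%N ->
  exists x y, [/\ x != 0, y != 0, d x y = 0, f x = a *: x & f y = a *: y].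
Proof.
move=> ma; set e := vbasis {:vT}.
have eb : basis_of {:vT} e by apply: vbasisP.
have [x x0 fx] : exists2 x, x != 0 & f x = a *: x.
  apply: eigenvalues_eigenvector.
  by rewrite -has_pred1 has_count count_eigenvalues ltnW.
have xr : rVof e x *m mxof e e f = a *: rVof e x.
  by rewrite mul_mxof (rVofK eb) fx linearZ.
have rx0 : rVof e x != 0 by rewrite rVof_eq0.
have [w' [k [wx wA]]] := mup_char_poly_gt1 rx0 xr ma.
pose w := vecof e w'.
have fw : f w = a *: w + k *: x.
  by rewrite (hom_vecof e eb) wA linearD !linearZ /= rVofK.
have dx := d_gt0 x0.
have k0 : k = 0.
  have := f_adj w x; rewrite fw fx innerDl !innerZl [RHS]d_sym innerZl (d_sym x).
  move=> /eqP; rewrite addrC -subr_eq0 addrK mulf_eq0 => /orP[/eqP //|/eqP dx0].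
  by rewrite dx0 ltxx in dx.
pose y := (- (d w x / d x x)) *: x + w; exists x, y; split=> //.
- apply/eqP => /(congr1 (rVof e)); rewrite linear0 /y linearD linearZ /=.
  rewrite vecofK // => /eqP; rewrite addrC addr_eq0 -scaleNr.
  by apply/negP.
- by rewrite d_sym d_linear mulNr divfK ?addNr // gt_eqF.
- rewrite linearD linearZ /= fx fw k0 scale0r addr0 scalerDr !scalerA.
  by rewrite mulrC.
Qed.

Lemma lambda1_eigenvector :
  lambda 1 f = 0 \/ exists2 x, x != 0 & f x = lambda 1 f *: x.
Proof.
rewrite /lambda /=; case: (posnP (size (eigenvalues f))) => [/size0nil ->|s0].
  by left.
by right; apply: eigenvalues_eigenvector; apply: mem_nth.
Qed.

(** The first alternative covers the default value of a list with fewer than two entries. Otherwise,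
    distinct eigenvalues have orthogonal eigenvectors by self-adjointness, and equal ones form a
    multiple root. *)
Lemma lambda2_eigenvectors :
  lambda 2 f = 0 \/
  (lambda 2 f <= lambda 1 f /\ exists x y, [/\ x != 0, y != 0, d x y = 0,
     f x = lambda 1 f *: x & f y = lambda 2 f *: y]).
Proof.
rewrite /lambda /=; set s := eigenvalues f.
case: (ltnP 1 (size s)) => [s1|/(nth_default 0) ->]; last by left.
have s_sorted : sorted (fun x y => y <= x) s.
  by apply: sort_sorted => x y; apply: le_total.
have le21 : s`_1 <= s`_0 by move: s_sorted s1; case: (s) => [|p [|q r]] //= /andP[].
right; split=> //; have [eq21|ne21] := eqVneq s`_1 s`_0.
  rewrite eq21; apply: mup_lchar_poly_gt1; rewrite -count_eigenvalues -/s.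
  move: s1 eq21; case: (s) => [|p [|q r]] //= _ ->; rewrite eqxx; lia.
have [x x0 fx] : exists2 x, x != 0 & f x = s`_0 *: x.
  by apply: eigenvalues_eigenvector; apply: mem_nth; apply: ltnW.
have [y y0 fy] : exists2 x, x != 0 & f x = s`_1 *: x.
  by apply: eigenvalues_eigenvector; apply: mem_nth.
exists x, y; split=> //; have := f_adj x y.
rewrite fx fy innerZl [RHS]d_sym innerZl (d_sym y) => /eqP.
rewrite -subr_eq0 -mulrBl mulf_eq0 subr_eq0 => /orP[/eqP e10|/eqP //].
by rewrite e10 eqxx in ne21.
Qed.

End SelfAdjoint.

(** * The complete complex on a set of vertices *)

Section CoreForms.
Variables (R : realFieldType) (V : finType).
Implicit Types (C : {set V}) (X Y : V -> V -> R).

Definition antisym X := forall u v, X u v = - X v u.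

Definition nrm C X := 2^-1 * \sum_(a in C) \sum_(b in C) X a b ^+ 2.

Definition divg C X a := \sum_(b in C) X a b.

Definition divn C X := \sum_(a in C) divg C X a ^+ 2.

(** For antisymmetric [X] the triples with a repeated vertex contribute 0, so this is the squared
    norm of the curl on the complete complex on [C]. *)
Definition curln C X :=
  6^-1 * \sum_(a in C) \sum_(b in C) \sum_(c in C) (X a b + X b c + X c a) ^+ 2.

Lemma nrm_ge0 C X : 0 <= nrm C X.
Proof.
apply: mulr_ge0; first by rewrite invr_ge0 ler0n.
by do 2! [apply: sumr_ge0 => ? _]; apply: sqr_ge0.
Qed.

Lemma divn_ge0 C X : 0 <= divn C X.
Proof. by apply: sumr_ge0 => ? _; apply: sqr_ge0. Qed.

Lemma curln_ge0 C X : 0 <= curln C X.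
Proof.
apply: mulr_ge0; first by rewrite invr_ge0 ler0n.
by do 3! [apply: sumr_ge0 => ? _]; apply: sqr_ge0.
Qed.

(** On a complete complex the Hodge Laplacian on edges is [#|C|] times the identity. Concretely,
    after expanding the square, each square term sums to [#|C|] times the sum of all [X a b ^+ 2],
    and each mixed term, summed over the two vertices its factors do not share, gives minus a
    squared divergence. *)
Lemma curlnE C X : antisym X -> curln C X = #|C|%:R * nrm C X - divn C X.
Proof.
move=> aX; pose S := \sum_(a in C) \sum_(b in C) X a b ^+ 2.
have E1 : \sum_(a in C) \sum_(b in C) \sum_(c in C) X a b ^+ 2 = #|C|%:R * S.
  rewrite mulr_sumr; apply: eq_bigr => a _; rewrite mulr_sumr.
  by apply: eq_bigr => b _; rewrite sumr_const mulr_natl.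
have E2 : \sum_(a in C) \sum_(b in C) \sum_(c in C) X b c ^+ 2 = #|C|%:R * S.
  by rewrite sumr_const mulr_natl.
have E3 : \sum_(a in C) \sum_(b in C) \sum_(c in C) X c a ^+ 2 = #|C|%:R * S.
  rewrite /S [in RHS]exchange_big mulr_sumr; apply: eq_bigr => a _ /=.
  by rewrite sumr_const mulr_natl.
have F1 : \sum_(a in C) \sum_(b in C) \sum_(c in C) X a b * X b c = - divn C X.
  rewrite exchange_big /= -sumrN; apply: eq_bigr => b _.
  rewrite /divg expr2 -mulNr -sumrN mulr_suml; apply: eq_bigr => a _.
  by rewrite mulr_sumr -aX.
have F2 : \sum_(a in C) \sum_(b in C) \sum_(c in C) X b c * X c a = - divn C X.
  rewrite -F1 exchange_big /=; apply: eq_bigr => b _.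
  by rewrite exchange_big.
have F3 : \sum_(a in C) \sum_(b in C) \sum_(c in C) X c a * X a b = - divn C X.
  rewrite -sumrN; apply: eq_bigr => a _.
  rewrite exchange_big /= /divg expr2 -mulNr -sumrN mulr_suml.
  by apply: eq_bigr => b _; rewrite mulr_sumr -aX.
have -> : curln C X = 6^-1 * (3 * (#|C|%:R * S) + 2 * (3 * - divn C X)).
  congr (_ * _).
  have -> (x y : R) : 3 * x + 2 * (3 * y) = (x + x + x) + 2 * (y + y + y).
    by ring.
  rewrite -{1}E1 -{1}E2 -{1}E3 -{1}F1 -{1}F2 -{1}F3 -!big_split mulr_sumr -big_split.
  apply: eq_bigr => a _; rewrite -!big_split mulr_sumr -big_split.
  apply: eq_bigr => b _; rewrite -!big_split mulr_sumr -big_split.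
  by apply: eq_bigr => c _ /=; ring.
by rewrite /nrm -/S; field.
Qed.

Lemma divn_le C X : antisym X -> divn C X <= #|C|%:R * nrm C X.
Proof. by move=> aX; rewrite -subr_ge0 -curlnE // curln_ge0. Qed.

Lemma nrm_leT C X : nrm C X <= nrm [set: V] X.
Proof.
have le (P : pred V) (F : V -> R) : (forall x, 0 <= F x) ->
    \sum_(x | P x) F x <= \sum_(x in [set: V]) F x.
  move=> F0; rewrite big_mkcond [leRHS]big_mkcond; apply: ler_sum => x _.
  by rewrite inE; case: ifP.
rewrite ler_pM2l ?invr_gt0 ?ltr0n //; apply: le_trans (le _ _ _).
  by apply: ler_sum => x _; apply: le => y; apply: sqr_ge0.
by move=> x; apply: sumr_ge0 => y _; apply: sqr_ge0.
Qed.

Lemma nrm0 C X : nrm C X = 0 -> {in C &, forall a b, X a b = 0}.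
Proof.
move=> /eqP; rewrite mulf_eq0 invr_eq0 pnatr_eq0 /= => /eqP /psumr_eq0P X0.
move=> a b aC bC; have /psumr_eq0P : \sum_(b in C) X a b ^+ 2 = 0.
  by apply: X0 aC => ? _; apply: sumr_ge0 => ? _; apply: sqr_ge0.
by move=> /(_ (fun _ _ => sqr_ge0 _)) /(_ b bC) /eqP; rewrite sqrf_eq0 => /eqP.
Qed.

End CoreForms.

(** * Quadratic forms on pendant triangles *)

Section Pendants.
Variables (R : realFieldType) (V I : finType) (C : {set V}) (a b : I -> V).
Implicit Types (X : V -> V -> R) (f g z : I -> R).
Hypothesis ab : forall i, a i != b i.

Definition core i := (a i \in C) && (b i \in C).

Definition eps i x y : R :=
  ((x == a i) && (y == b i))%:R - ((x == b i) && (y == a i))%:R.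

(** Superposition of unit flows on the edges from [a i] to [b i] inside [C]. This is the adjoint of
    evaluating a flow on these edges, which is the content of [sum_spread]; the factor 2 there
    counts both orientations. *)
Definition spread z x y := \sum_(i | core i) z i * eps i x y.

Definition sqn f := \sum_i f i ^+ 2.

(* When all triples of C are triangles, [(c - #|C|) * sqn z - penf c z] is, up to
   a positive factor, the Schur complement of [c - curl^* curl] onto the values
   [z] on the pendant triangles; hence its shape. *)
Definition penf c z := \sum_(i | ~~ core i) z i ^+ 2
  + (c * nrm C (spread z) - divn C (spread z)) / (c - 2).

Lemma sqn_ge0 f : 0 <= sqn f.
Proof. by apply: sumr_ge0 => i _; apply: sqr_ge0. Qed.

Lemma eps_antisym i : antisym (eps i).
Proof. by move=> x y; rewrite /eps opprB andbC [in X in _ - X]andbC. Qed.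

Lemma spread_antisym z : antisym (spread z).
Proof.
move=> x y; rewrite /spread -sumrN; apply: eq_bigr => i _.
by rewrite eps_antisym mulrN.
Qed.

Lemma eps_ab i : eps i (a i) (b i) = 1.
Proof. rewrite /eps !eqxx /=. by rewrite (negPf (ab i)) subr0. Qed.

Lemma sum_delta (F : V -> R) x : x \in C -> \sum_(y in C) F y * (y == x)%:R = F x.
Proof.
move=> xC; rewrite (bigD1 x) //= eqxx mulr1 big1 ?addr0 // => y /andP[_ /negPf->].
by rewrite mulr0.
Qed.

Lemma sum_eps (F : V -> V -> R) i : core i ->
  \sum_(x in C) \sum_(y in C) F x y * eps i x y = F (a i) (b i) - F (b i) (a i).
Proof.
case/andP=> aC bC.
have E x y : F x y * eps i x y
    = F x y * (y == b i)%:R * (x == a i)%:R - F x y * (y == a i)%:R * (x == b i)%:R.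
  rewrite /eps; do 4 case: eqP => _ /=; ring.
under eq_bigr => x _ do under eq_bigr => y _ do rewrite E.
under eq_bigr => x _ do rewrite sumrB -!mulr_suml !sum_delta //.
by rewrite sumrB !(sum_delta (fun x => F x _)).
Qed.

Lemma sum_spread X z : antisym X ->
  \sum_(x in C) \sum_(y in C) X x y * spread z x y
    = 2 * \sum_(i | core i) z i * X (a i) (b i).
Proof.
move=> aX; have E x y : X x y * spread z x y
    = \sum_(i | core i) z i * (X x y * eps i x y).
  by rewrite mulr_sumr; apply: eq_bigr => i _; ring.
under eq_bigr => x _ do under eq_bigr => y _ do rewrite E.
under eq_bigr => x _ do rewrite exchange_big /=.
rewrite exchange_big mulr_sumr; apply: eq_bigr => i ci /=.
under eq_bigr => x _ do rewrite -mulr_sumr.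
by rewrite -mulr_sumr sum_eps // (aX (b i)); ring.
Qed.

Lemma nrm_eps i : core i -> nrm C (eps i) = 1.
Proof.
move=> ci; rewrite /nrm.
under eq_bigr => x _ do under eq_bigr => y _ do rewrite expr2.
by rewrite sum_eps // (eps_antisym _ (b i)) eps_ab; field.
Qed.

Lemma divn_eps i : core i -> divn C (eps i) = 2.
Proof.
move=> ci; have /andP[aC bC] := ci.
have E x : divg C (eps i) x = (x == a i)%:R - (x == b i)%:R.
  have F y : eps i x y
     = (x == a i)%:R * (y == b i)%:R - (x == b i)%:R * (y == a i)%:R.
    by rewrite /eps; do 4 case: eqP => _ /=; ring.
  rewrite /divg (eq_bigr _ (fun y _ => F y)) sumrB.
  by rewrite !(sum_delta (fun _ => _)).
rewrite /divn; under eq_bigr => x _ do rewrite E expr2 mulrBr.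
by rewrite sumrB !sum_delta // !eqxx (eq_sym (b i)) (negPf (ab i)) /=; ring.
Qed.

(* The divergence terms are absorbed through [divn W <= #|C| * nrm W] applied to
   [W = X - spread z / (c - #|C|)]. *)
Lemma core_bound X c z : antisym X -> (0 < #|C|)%N -> #|C|%:R < c ->
  (#|C|%:R - c) * nrm C X - divn C X + 2 * \sum_(i | core i) z i * X (a i) (b i)
    <= (c * nrm C (spread z) - divn C (spread z)) / (c * (c - #|C|%:R)).
Proof.
move=> aX C0 hc; rewrite -sum_spread //.
set h : R := #|C|%:R in hc *; set Y := spread z.
have h0 : 0 < h by rewrite ltr0n.
set P := \sum_(x in C) _; pose D := \sum_(x in C) divg C X x * divg C Y x.
pose T := c - h; have T0 : 0 < T by rewrite subr_gt0.
have c0 : 0 < c by apply: lt_trans hc.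
have aY : antisym Y by apply: spread_antisym.
pose W x y := X x y - Y x y / T.
have aW : antisym W by move=> x y; rewrite /W aX aY; ring.
have nW : nrm C W = nrm C X - P / T + nrm C Y / T ^+ 2.
  have -> : nrm C X - P / T + nrm C Y / T ^+ 2
     = 2^-1 * (2 * nrm C X + - 2 * P / T + 2 * nrm C Y / T ^+ 2).
    by field; rewrite gt_eqF.
  rewrite /nrm !mulrA divff ?mul1r ?pnatr_eq0 //; congr (_ * _).
  rewrite mulr_sumr !mulr_suml -!big_split; apply: eq_bigr => x _ /=.
  rewrite mulr_sumr !mulr_suml -!big_split; apply: eq_bigr => y _ /=.
  by rewrite /W; field; rewrite gt_eqF.
have dW : divn C W = divn C X - 2 * D / T + divn C Y / T ^+ 2.
  rewrite /divn /D mulr_sumr !mulr_suml -sumrN -!big_split.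
  apply: eq_bigr => x _ /=.
  have -> : divg C W x = divg C X x - divg C Y x / T.
    by rewrite /divg mulr_suml -sumrB.
  by field; rewrite gt_eqF.
have sq : 0 <= c ^+ 2 * divn C X - 2 * c * D + divn C Y.
  rewrite /divn /D !mulr_sumr -sumrN -!big_split; apply: sumr_ge0 => x _ /=.
  set u := divg _ _ _; set v := divg _ _ _.
  have -> : c ^+ 2 * u ^+ 2 - 2 * c * (u * v) + v ^+ 2 = (c * u - v) ^+ 2 by ring.
  exact: sqr_ge0.
have := divn_le C aW; rewrite -/h nW dW => dn.
rewrite -subr_ge0.
(* The weights [T / h] and [1 / (h * c)] make the cross terms [D] cancel and leave exactly one copy
   of [divn C X]. *)
have -> : (c * nrm C Y - divn C Y) / (c * (c - h))
      - ((h - c) * nrm C X - divn C X + P)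
    = (h * (nrm C X - P / T + nrm C Y / T ^+ 2)
       - (divn C X - 2 * D / T + divn C Y / T ^+ 2)) * (T / h)
      + (c ^+ 2 * divn C X - 2 * c * D + divn C Y) / (h * c).
  by rewrite /T; field; rewrite !gt_eqF //= subr_gt0.
apply: addr_ge0; first by rewrite mulr_ge0 ?subr_ge0 // divr_ge0 ?ltW.
by rewrite divr_ge0 // mulr_ge0 ?ltW.
Qed.

(** Here [n i] stands for the weight of the edges of pendant triangle [i] that are not inside [C].
    Each [n i] is eliminated separately, by completing a square in [z i - X (a i) (b i)] for core
    triangles; what then remains of [X] lives on [C] and is handled by [core_bound]. *)
Lemma rayleigh_bound X c z n Q N : antisym X -> (1 < #|C|)%N -> #|C|%:R < c ->
  (forall i, core i -> (z i - X (a i) (b i)) ^+ 2 <= 2 * n i) ->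
  (forall i, ~~ core i -> z i ^+ 2 <= 3 * n i) ->
  Q <= curln C X + sqn z -> nrm C X + \sum_i n i <= N ->
  Q - c * N
    <= (c - 2) / (c * (c - #|C|%:R)) * (penf c z - (c - #|C|%:R) * sqn z).
Proof.
move=> aX C1 hc zc zn Qle Nle; set h : R := #|C|%:R in hc *.
have h2 : 2 <= h by rewrite ler_nat.
have c2 : 2 < c by apply: le_lt_trans hc.
have c0 : 0 < c by lra.
have T0 : 0 < c - h by lra.
have cN := ler_wpM2l (ltW c0) Nle.
apply: (@le_trans _ _ (curln C X + sqn z - c * (nrm C X + \sum_i n i))).
  by lra.
rewrite curlnE //; have := core_bound z aX (ltnW C1) hc; rewrite -/h => cb.
have loc : \sum_i (z i ^+ 2 - c * n i) <=
    2 * \sum_(i | core i) z i * X (a i) (b i)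
    + (c - 2) / (c * (c - h)) * \sum_(i | ~~ core i) z i ^+ 2
    - (c - 2) / c * sqn z.
  rewrite [leLHS](bigID core) /= /sqn [\sum_i z i ^+ 2](bigID core) /=.
  set s := (c - 2) / c; set k := (c - 2) / (c * _).
  rewrite mulrDr opprD addrACA; apply: lerD; rewrite !mulr_sumr -sumrB;
    apply: ler_sum => i ci.
    rewrite {}/s {k}; have := zc i ci; set x := X _ _; move: (z i) (n i) => u v uv.
    have cv := ler_wpM2l (ltW c0) uv.
    rewrite -subr_ge0.
    have -> : 2 * (u * x) - (c - 2) / c * u ^+ 2 - (u ^+ 2 - c * v)
       = (c * (2 * v) - c * (u - x) ^+ 2) / 2 + (u - x - 2 * u / c) ^+ 2 * (c / 2).
      by field; rewrite gt_eqF.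
    apply: addr_ge0; first by rewrite divr_ge0 ?ler0n // subr_ge0.
    by rewrite mulr_ge0 ?sqr_ge0 // divr_ge0 ?ltW.
  rewrite {}/s {}/k; have := zn i ci; move: (z i) (n i) => u v uv.
  have cv := ler_wpM2l (ltW c0) uv.
  rewrite -subr_ge0.
  (* The slack is a square plus a term with numerator [h - 2]; this is where [C] must have at least
     two vertices. *)
  have -> : (c - 2) / (c * (c - h)) * u ^+ 2 - (c - 2) / c * u ^+ 2
         - (u ^+ 2 - c * v)
     = (c * (3 * v) - c * u ^+ 2) / 3
       + ((c - 3) ^+ 2 / (3 * c) + (h - 2) / (c * (c - h))) * u ^+ 2.
    by field; rewrite !gt_eqF.
  apply: addr_ge0; first by rewrite divr_ge0 ?ler0n // subr_ge0.
  apply: mulr_ge0 (sqr_ge0 _); apply: addr_ge0; apply: divr_ge0.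
  - exact: sqr_ge0.
  - by rewrite mulr_ge0 ?ltW.
  - by rewrite subr_ge0.
  - by rewrite mulr_ge0 ?ltW.
have -> : sqn z = \sum_i (z i ^+ 2 - c * n i) + c * \sum_i n i.
  by rewrite sumrB -mulr_sumr subrK.
move: loc cb; rewrite /penf sumrB -mulr_sumr -/(sqn z).
set t := sqn z; set m := \sum_i n i; set w := \sum_(i | core i) _.
set k := \sum_(i | ~~ _) _; set y := nrm C (spread z); set dy := divn _ (spread _).
move=> loc cb.
have -> : (c - 2) / (c * (c - h)) * (k + (c * y - dy) / (c - 2)
     - (c - h) * (t - c * m + c * m))
  = (c * y - dy) / (c * (c - h)) + (c - 2) / (c * (c - h)) * k - (c - 2) / c * t.
  by field; rewrite !gt_eqF //; lra.
by lra.
Qed.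

(** Bessel's inequality for an orthogonal pair, with denominators cleared: the gap, times
    [sqn f * sqn g], is the squared norm of the scaled residual of [phi] after projection to the
    plane of [f] and [g]. *)
Lemma bessel phi f g : 0 < sqn f -> 0 < sqn g -> \sum_i f i * g i = 0 ->
  (\sum_i f i * phi i) ^+ 2 * sqn g + (\sum_i g i * phi i) ^+ 2 * sqn f
    <= sqn f * sqn g * sqn phi.
Proof.
move=> f0 g0 fg; set p := \sum_i f i * phi i; set q := \sum_i g i * phi i.
set F := sqn f in f0 *; set G := sqn g in g0 *.
rewrite -subr_ge0 -(pmulr_rge0 _ (mulr_gt0 f0 g0)).
have E (s t u : R) : \sum_i (s * phi i - t * f i - u * g i) ^+ 2
    = s ^+ 2 * sqn phi + t ^+ 2 * F + u ^+ 2 * G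
      + - (2 * s * t) * p + - (2 * s * u) * q + 2 * t * u * \sum_i f i * g i.
  rewrite /sqn /p /q !mulr_sumr -!big_split.
  by apply: eq_bigr => i _ /=; ring.
have -> : F * G * (F * G * sqn phi - (p ^+ 2 * G + q ^+ 2 * F))
   = \sum_i (F * G * phi i - p * G * f i - q * F * g i) ^+ 2.
  by rewrite E fg; ring.
by apply: sumr_ge0 => i _; apply: sqr_ge0.
Qed.

Lemma curln_eps i : core i -> curln C (eps i) = #|C|%:R - 2.
Proof.
by move=> ci; rewrite (curlnE _ (eps_antisym i)) nrm_eps // divn_eps // mulr1.
Qed.

(** For [c >= #|C|] this exhibits [penf c] as a nonnegative combination of squares of linear
    functionals of [z], the shape to which Bessel's inequality applies term by term. *)
Lemma penf_curln c z : 2 < c -> penf c z = \sum_(i | ~~ core i) z i ^+ 2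
  + ((c - #|C|%:R) * nrm C (spread z) + curln C (spread z)) / (c - 2).
Proof.
move=> c2; rewrite /penf (curlnE _ (spread_antisym z)); congr (_ + _ / _); ring.
Qed.

(** * Trace bounds for positive forms on an orthogonal pair *)

Section Trace.
Variables (f g : I -> R).
Hypotheses (f0 : 0 < sqn f) (g0 : 0 < sqn g) (fg : \sum_i f i * g i = 0).

Lemma bessel_core (phi : I -> R) :
  (\sum_(i | core i) f i * phi i) ^+ 2 * sqn g
  + (\sum_(i | core i) g i * phi i) ^+ 2 * sqn f
    <= sqn f * sqn g * \sum_(i | core i) phi i ^+ 2.
Proof.
pose psi i := if core i then phi i else 0.
have E h : \sum_(i | core i) h i * phi i = \sum_i h i * psi i.
  by rewrite big_mkcond; apply: eq_bigr => i _; rewrite /psi; case: ifP; rewrite ?mulr0.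
have -> : \sum_(i | core i) phi i ^+ 2 = sqn psi.
  rewrite /sqn big_mkcond; apply: eq_bigr => i _; rewrite /psi.
  by case: ifP; rewrite ?expr0n.
by rewrite !E; apply: bessel.
Qed.

Lemma trace_scale (k p q s t u v : R) : 0 <= k -> p * s + q * t <= u * v ->
  k * p * s + k * q * t <= u * (k * v).
Proof. by move=> k0 le; rewrite -!mulrA (mulrCA u) -mulrDr ler_wpM2l. Qed.

Lemma trace_sum (J : finType) (P : pred J) (p q v : J -> R) s t u :
  (forall j, P j -> p j * s + q j * t <= u * v j) ->
  (\sum_(j | P j) p j) * s + (\sum_(j | P j) q j) * t <= u * \sum_(j | P j) v j.
Proof.
by move=> le; rewrite mulr_sumr !mulr_suml -big_split; apply: ler_sum.
Qed.

(** The sum over [core i] is the trace of the form [nrm C (spread z)], since [spread] sends the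
    basis vector of a core index [i] to [eps i] and all others to 0. *)
Lemma nrm_trace : nrm C (spread f) * sqn g + nrm C (spread g) * sqn f
  <= sqn f * sqn g * \sum_(i | core i) nrm C (eps i).
Proof.
rewrite /nrm -mulr_sumr; apply: trace_scale; first by rewrite invr_ge0 ler0n.
rewrite [X in _ <= _ * X]exchange_big; apply: trace_sum => x _.
rewrite [X in _ <= _ * X]exchange_big; apply: trace_sum => y _.
exact: bessel_core.
Qed.

Lemma curln_trace : curln C (spread f) * sqn g + curln C (spread g) * sqn f
  <= sqn f * sqn g * \sum_(i | core i) curln C (eps i).
Proof.
rewrite /curln -mulr_sumr; apply: trace_scale; first by rewrite invr_ge0 ler0n.
rewrite [X in _ <= _ * X]exchange_big; apply: trace_sum => x _.
rewrite [X in _ <= _ * X]exchange_big; apply: trace_sum => y _.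
rewrite [X in _ <= _ * X]exchange_big; apply: trace_sum => w _.
have E h : spread h x y + spread h y w + spread h w x
    = \sum_(i | core i) h i * (eps i x y + eps i y w + eps i w x).
  by rewrite /spread -!big_split; apply: eq_bigr => i _ /=; rewrite !mulrDr.
by rewrite !E; apply: bessel_core.
Qed.

Lemma noncore_trace :
  (\sum_(i | ~~ core i) f i ^+ 2) * sqn g + (\sum_(i | ~~ core i) g i ^+ 2) * sqn f
    <= sqn f * sqn g * \sum_(i | ~~ core i) 1.
Proof.
apply: trace_sum => i _.
have := bessel (fun j => (j == i)%:R) f0 g0 fg.
have D (h : I -> R) : \sum_j h j * (j == i)%:R = h i.
  rewrite (bigD1 i) //= eqxx mulr1 big1 ?addr0 // => j /negPf->.
  by rewrite mulr0.
have -> : sqn (fun j => (j == i)%:R) = 1.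
  by rewrite /sqn; under eq_bigr => j _ do rewrite expr2; rewrite D eqxx.
by rewrite !D.
Qed.

(** The trace of [penf c] is exactly [#|I|]: a noncore index contributes 1, and a core index
    contributes [((c - h) * 1 + (h - 2)) / (c - 2) = 1], where [h = #|C|]. *)
Lemma penf_trace c : 2 < c -> #|C|%:R <= c ->
  penf c f * sqn g + penf c g * sqn f <= sqn f * sqn g * #|I|%:R.
Proof.
move=> c2 hc; rewrite !penf_curln //; set h : R := #|C|%:R in hc *.
have s0 : 0 <= (c - 2)^-1 by rewrite invr_ge0; lra.
have T0 : 0 <= c - h by lra.
have := nrm_trace; have := curln_trace; have := noncore_trace.
rewrite [\sum_(i | core i) curln _ _](eq_bigr (fun=> h - 2)); last exact: curln_eps.
rewrite [\sum_(i | core i) nrm _ _](eq_bigr (fun=> 1)); last exact: nrm_eps.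
have -> : #|I|%:R = \sum_(i | core i) 1 + \sum_(i | ~~ core i) 1 :> R.
  by rewrite -(bigID core predT (fun=> 1)) sumr_const.
have -> : \sum_(i | core i) (h - 2) = (h - 2) * \sum_(i | core i) 1.
  by rewrite mulr_sumr mulr1.
set k := \sum_(i | ~~ _) 1; set m := \sum_(i | core i) 1 => nc ct nt.
set N := \sum_(i | ~~ core i) f i ^+ 2 in nc *.
set N' := \sum_(i | ~~ core i) g i ^+ 2 in nc *.
rewrite -subr_ge0; set F := sqn f in nc ct nt *; set G := sqn g in nc ct nt *.
set y := nrm C _ in nt *; set y' := nrm C (spread g) in nt *.
set u := curln C _ in ct *; set u' := curln C (spread g) in ct *.
have -> : F * G * (m + k) - ((N + ((c - h) * y + u) / (c - 2)) * G
      + (N' + ((c - h) * y' + u') / (c - 2)) * F)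
  = (F * G * k - (N * G + N' * F))
    + (c - h) * (c - 2)^-1 * (F * G * m - (y * G + y' * F))
    + (c - 2)^-1 * (F * G * ((h - 2) * m) - (u * G + u' * F)).
  by field; lra.
apply: addr_ge0; first apply: addr_ge0; rewrite ?subr_ge0 //.
  by rewrite !mulr_ge0 // subr_ge0.
by rewrite mulr_ge0 // subr_ge0.
Qed.

End Trace.

(* [class i] is a signed indicator of the pendant triangles sharing the core
   edge of [i]; it is an eigenvector of [gram] with eigenvalue the size of the class. *)
Definition class i j : R :=
  if core i then (if core j then eps j (a i) (b i) else 0) else (j == i)%:R.

Lemma class_ii i : class i i = 1.
Proof. by rewrite /class; case: ifP => ci; rewrite ?eqxx ?ci ?eps_ab. Qed.

Lemma class_gt0 i : 0 < sqn (class i).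
Proof.
rewrite /sqn (bigD1 i) //= class_ii expr1n ltr_wpDr //.
by apply: sumr_ge0 => j _; apply: sqr_ge0.
Qed.

Lemma class_noncore i z : ~~ core i -> \sum_j class i j * z j = z i.
Proof.
move=> /negPf nc; rewrite /class nc (bigD1 i) //= eqxx mul1r big1 ?addr0 //.
by move=> j /negPf->; rewrite mul0r.
Qed.

Lemma eps_neq0 i x y : eps i x y != 0 ->
  (x = a i /\ y = b i) \/ (x = b i /\ y = a i).
Proof.
rewrite /eps; case: andP => [[/eqP-> /eqP->]|_]; first by left.
by case: andP => [[/eqP-> /eqP->]|_]; [right | rewrite subrr eqxx].
Qed.

Lemma spread_class i x y : core i ->
  spread (class i) x y = sqn (class i) * eps i x y.
Proof.
move=> ci; rewrite /spread /sqn mulr_suml big_mkcond; apply: eq_bigr => j _ /=.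
rewrite /class ci; case: (core j); last by rewrite expr0n mul0r.
rewrite expr2 -mulrA; have [->|e0] := eqVneq (eps j (a i) (b i)) 0.
  by rewrite !mul0r.
congr (_ * _); case: (eps_neq0 e0) => -[ai bi].
  by rewrite ai bi eps_ab mul1r /eps ai bi.
by rewrite ai bi [eps j (b j) _]eps_antisym eps_ab mulN1r /eps ai bi opprB.
Qed.

(** For core [i] with class size [m], [spread (class i)] is [m] times a unit flow, with norm term
    [m ^+ 2] and divergence term [2 * m ^+ 2]. The factor [c - 2] cancels, so the Rayleigh quotient
    is bounded below by [m] whatever [c] is. *)
Lemma penf_class c i : 2 < c -> penf c (class i) >= sqn (class i) ^+ 2.
Proof.
move=> c2; have [ci|ci] := boolP (core i); last first.
  have s1 : sqn (class i) = 1.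
    rewrite -[RHS](class_ii i) -(class_noncore _ ci).
    by apply: eq_bigr => j _; rewrite expr2.
  rewrite s1 expr1n /penf (bigD1 i) //= class_ii expr1n -addrA lerDl.
  apply: addr_ge0; first by apply: sumr_ge0 => j _; apply: sqr_ge0.
  have Y0 x y : spread (class i) x y = 0.
    apply: big1 => j cj; rewrite /class (negPf ci).
    by case: (j =P i) => [ji|_]; [rewrite -ji cj in ci | rewrite mul0r].
  have -> : divn C (spread (class i)) = 0.
    by apply: big1 => x _; rewrite /divg big1 ?expr0n.
  rewrite subr0; apply: divr_ge0; last by lra.
  by apply: mulr_ge0 (nrm_ge0 _ _); lra.
rewrite /penf; have -> : nrm C (spread (class i)) = sqn (class i) ^+ 2.
  rewrite -[RHS]mulr1 -(nrm_eps ci) /nrm [RHS]mulrCA; congr (_ * _).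
  rewrite mulr_sumr; apply: eq_bigr => x _; rewrite mulr_sumr.
  by apply: eq_bigr => y _; rewrite spread_class // exprMn.
have -> : divn C (spread (class i)) = sqn (class i) ^+ 2 * 2.
  rewrite -(divn_eps ci) /divn mulr_sumr; apply: eq_bigr => x _.
  rewrite /divg -exprMn mulr_sumr; congr (_ ^+ 2).
  by apply: eq_bigr => y _; rewrite spread_class.
rewrite (mulrC c) -mulrBr mulfK; last by rewrite gt_eqF // subr_gt0.
by rewrite lerDr sumr_ge0 // => j _; apply: sqr_ge0.
Qed.

(** The limit of [penf c] as [c] tends to infinity. By [gram_class] its matrix is [class]. *)
Definition gram z := \sum_(i | ~~ core i) z i ^+ 2 + nrm C (spread z).

Lemma penfE c z : 2 < c ->
  penf c z = gram z + (2 * nrm C (spread z) - divn C (spread z)) / (c - 2).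
Proof. by move=> c2; rewrite /penf /gram; field; lra. Qed.

Lemma class_sym i j : class i j = class j i.
Proof.
rewrite /class; case ci: (core i); case cj: (core j); last 3 first.
- by case: eqP ci cj => // -> ->.
- by case: eqP ci cj => // -> ->.
- by rewrite eq_sym.
rewrite /eps !(eq_sym (a i)) !(eq_sym (b i)); congr (_ - (_ : bool)%:R).
by rewrite andbC.
Qed.

Lemma class_sqr_sign i j u v : 2 * (u * class i j * v)
  <= class i j ^+ 2 * (u ^+ 2 + v ^+ 2).
Proof.
have : class i j \in [:: 0; 1; -1].
  rewrite /class /eps; case: ifP => _; last by case: eqP; rewrite !inE eqxx ?orbT.
  case: ifP => _; last by rewrite !inE eqxx.
  by do 2 case: (_ && _); rewrite !inE ?subrr ?subr0 ?sub0r eqxx ?orbT.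
have := sqr_ge0 (u - v); have := sqr_ge0 (u + v).
by rewrite !inE => p m /or3P[] /eqP ->; nra.
Qed.

Lemma gram_class z : gram z = \sum_i \sum_j z i * class i j * z j.
Proof.
rewrite /gram [RHS](bigID core) /= addrC; congr (_ + _).
  apply: eq_bigr => i ci.
  under eq_bigr => j _ do rewrite -mulrA.
  by rewrite -mulr_sumr class_noncore // expr2.
rewrite /nrm; under [in LHS]eq_bigr => x _ do under eq_bigr => y _ do rewrite expr2.
rewrite sum_spread; last exact: spread_antisym.
rewrite mulKf ?pnatr_eq0 //; apply: eq_bigr => i ci.
rewrite /spread mulr_sumr big_mkcond /=; apply: eq_bigr => j _.
by rewrite /class ci; case: ifP => _; rewrite ?mulr0 ?mul0r //; ring.
Qed.

(** The entries of [class] are 0, 1 or -1, so each off-diagonal product is bounded by the mean of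
    two squares. The resulting diagonal weights are the row sums of squares, which are the class
    sizes. *)
Lemma gram_le z : gram z <= \sum_i sqn (class i) * z i ^+ 2.
Proof.
rewrite gram_class -(ler_pM2l (ltr0n _ 2)) .
pose S := \sum_i \sum_j class i j ^+ 2 * (z i ^+ 2 + z j ^+ 2).
have -> : 2 * (\sum_i sqn (class i) * z i ^+ 2) = S.
  have E : \sum_i sqn (class i) * z i ^+ 2 = \sum_i \sum_j class i j ^+ 2 * z j ^+ 2.
    rewrite exchange_big; apply: eq_bigr => i _; rewrite mulr_suml.
    by apply: eq_bigr => j _; rewrite class_sym.
  rewrite mulr_natl mulr2n {2}E -big_split; apply: eq_bigr => i _ /=.
  rewrite /sqn mulr_suml -big_split; apply: eq_bigr => j _ /=.
  by rewrite mulrDr.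
rewrite mulr_sumr; apply: ler_sum => i _; rewrite mulr_sumr.
by apply: ler_sum => j _; apply: class_sqr_sign.
Qed.

Lemma exists_class z mu : 0 < sqn z -> mu * sqn z <= gram z ->
  exists i, mu <= sqn (class i).
Proof.
move=> z0 le; apply/existsP; apply: contraLR le => /existsPn lt.
rewrite -ltNge; apply: le_lt_trans (gram_le z) _.
rewrite /sqn mulr_sumr -subr_gt0 -sumrB.
have [i zi] : exists i, z i != 0.
  apply/existsP; apply: contraLR z0 => /existsPn zz.
  by rewrite -leNgt /sqn big1 // => i _; have /negbNE/eqP-> := zz i; rewrite expr0n.
have pos j : 0 < mu - sqn (class j) by rewrite subr_gt0 ltNge lt.
rewrite (bigD1 i) //= -mulrBl; apply: ltr_pwDl.
  by apply: mulr_gt0 (pos i) _; rewrite lt0r sqrf_eq0 zi sqr_ge0.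
by apply: sumr_ge0 => j _; rewrite -mulrBl mulr_ge0 ?sqr_ge0 ?(ltW (pos j)).
Qed.

(* If the coefficient of [1 / (c - 2)] in [penf c z1] is nonnegative, keep
   [z1]; otherwise [gram z1 >= penf l1 z1], and a class vector does at least as
   well. *)
Lemma exists_test_vector l1 l2 mu z1 : 2 < l2 -> l2 <= l1 -> 0 <= mu ->
  0 < sqn z1 -> mu * sqn z1 <= penf l1 z1 ->
  exists2 f, 0 < sqn f & mu * sqn f <= penf l2 f.
Proof.
move=> l22 l21 mu0 z10 le; have l12 : 2 < l1 by apply: lt_le_trans l21.
pose E := 2 * nrm C (spread z1) - divn C (spread z1).
have [E0|E0] := leP 0 E.
  exists z1 => //; apply: le_trans le _; rewrite !penfE // -/E lerD2l.
  by rewrite ler_wpM2l // lef_pV2 ?posrE ?subr_gt0 // lerD2r.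
have [|i mi] := @exists_class z1 mu z10.
  apply: le_trans le _; rewrite penfE // -/E gerDl.
  by rewrite pmulr_lle0 ?invr_gt0 ?subr_gt0 // ltW.
exists (class i); first exact: class_gt0.
apply: le_trans (penf_class i l22); rewrite expr2 ler_wpM2r //; exact: sqn_ge0.
Qed.

(** Two orthogonal vectors are tested against the single form [penf l2]: [f], with quotient at least
    [l1 - h], comes from [exists_test_vector], and [g], with quotient at least [l2 - h], is chosen
    in the plane of [z1] and [z2]. *)
Lemma top_two_bound l1 l2 z1 z2 :
  2 <= #|C|%:R :> R -> #|C|%:R < l2 -> l2 <= l1 ->
  (forall s t, (s != 0) || (t != 0) -> 0 < sqn (fun i => s * z1 i + t * z2 i)) ->
  (forall s t, (l2 - #|C|%:R) * sqn (fun i => s * z1 i + t * z2 i)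
     <= penf l2 (fun i => s * z1 i + t * z2 i)) ->
  (l1 - #|C|%:R) * sqn z1 <= penf l1 z1 ->
  l1 + l2 <= (2 * #|C| + #|I|)%:R.
Proof.
set h : R := #|C|%:R => h2 hl l21 pos le2 le1.
have z10 : 0 < sqn z1.
  have := pos 1 0; rewrite oner_eq0 => /(_ isT); congr (_ < _).
  by apply: eq_bigr => i _; rewrite mul1r mul0r addr0.
have [f f0 lef] : exists2 f, 0 < sqn f & (l1 - h) * sqn f <= penf l2 f.
  by apply: exists_test_vector le1 => //; lra.
have [s [t [st fg]]] : exists s t, (s != 0) || (t != 0)
    /\ \sum_i f i * (s * z1 i + t * z2 i) = 0.
  have E s t : \sum_i f i * (s * z1 i + t * z2 i)
      = s * \sum_i f i * z1 i + t * \sum_i f i * z2 i.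
    by rewrite !mulr_sumr -big_split; apply: eq_bigr => i _ /=; ring.
  set p := \sum_i f i * z1 i; set q := \sum_i f i * z2 i.
  (* The combination [q * z1 - p * z2] is orthogonal to [f]; when [p = q = 0], [z1] itself is. *)
  have [pq|pq] := boolP ((q != 0) || (- p != 0)).
    by exists q, (- p); split; rewrite // E -/p -/q; ring.
  exists 1, 0; rewrite oner_eq0 E -/p; split=> //.
  move: pq; rewrite negb_or !negbK oppr_eq0 => /andP[_ /eqP->]; ring.
have g0 := pos s t st; have leg := le2 s t.
set g := fun i => s * z1 i + t * z2 i in fg g0 leg.
have l22 : 2 < l2 by lra.
have := penf_trace f0 g0 fg l22 (ltW hl); rewrite natrD natrM -/h.
move: (sqn f) (sqn g) (penf l2 f) (penf l2 g) f0 g0 lef leg => F G pf pg F0 G0 lef leg.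
have := ler_wpM2r (ltW G0) lef; have := ler_wpM2r (ltW F0) leg => H1 H2 H3.
rewrite -(ler_pM2l (mulr_gt0 F0 G0)).
by move: H1 H2 H3; lra.
Qed.

End Pendants.

(** * Pendant triangles of a graph *)

Lemma sum_uniq_le (R : realFieldType) (T : finType) (P : pred T) (s : seq T)
    (F : T -> R) : uniq s -> (forall x, 0 <= F x) -> (forall x, x \in s -> P x) ->
  \sum_(x <- s) F x <= \sum_(x | P x) F x.
Proof.
move=> us F0 sP; rewrite big_uniq //= [leRHS](bigID (mem s)) /=.
rewrite (eq_bigl (fun x => P x && (x \in s))).
  by rewrite lerDl sumr_ge0.
by move=> x; case: (boolP (x \in s)) => [/sP->|]; rewrite ?andbT ?andbF.
Qed.

Lemma sum_seq_ge (R : realFieldType) (T : finType) (P : pred T) (s : seq T)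
    (F : T -> R) : uniq s -> (forall x, 0 <= F x) -> (forall x, P x -> x \in s) ->
  \sum_(x | P x) F x <= \sum_(x <- s) F x.
Proof.
move=> us F0 Ps; rewrite big_uniq //= [leRHS](bigID P) /=.
rewrite (eq_bigl (fun x => (x \in s) && P x)).
  by rewrite lerDl sumr_ge0.
by move=> x; case: (boolP (P x)) => [/Ps->|]; rewrite ?andbT ?andbF.
Qed.

Section Pendant.
Variables (R : realFieldType) (V : finType) (e : rel V).
Local Notation T := (triangles e).

Definition verts k := [set v : V | (k <= deg2 e v)%N].
Local Notation C := (verts 2).

Lemma triangle_card t : t \in T -> #|t| = 3.
Proof. by rewrite inE => /andP[/eqP]. Qed.

Lemma triangle_sub t : t \in T -> t \subset verts 1.
Proof.
move=> tT; apply/subsetP => v vt; rewrite inE card_gt0.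
by apply/set0Pn; exists t; rewrite inE tT.
Qed.

Lemma triangle_uniq t t' v : t \in T -> t' \in T -> v \in t -> v \in t' ->
  v \notin C -> t = t'.
Proof.
move=> tT tT' vt vt'; rewrite inE -ltnNge ltnS => /card_le1_eqP.
by apply; rewrite inE ?tT ?tT'.
Qed.

Lemma verts21 : C \subset verts 1.
Proof. by apply/subsetP => v; rewrite !inE; apply: ltnW. Qed.

Definition pendant := {t : {set V} | (t \in T) && ~~ (t \subset C)}.

Lemma pendantT (i : pendant) : val i \in T.
Proof. by have /andP[] := valP i. Qed.

Lemma pendant_choice : exists a b u : pendant -> V, forall i,
  [/\ val i = [set a i; b i; u i], a i != b i, a i != u i, b i != u i & u i \notin C].
Proof.
suff /fin_all_exists[f fP] : forall i : pendant, exists p : V * V * V,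
    [/\ val i = [set p.1.1; p.1.2; p.2], p.1.1 != p.1.2, p.1.1 != p.2,
        p.1.2 != p.2 & p.2 \notin C].
  by exists (fun i => (f i).1.1), (fun i => (f i).1.2), (fun i => (f i).2).
move=> i; have /andP[tT /subsetPn[u ut uC]] := valP i.
have : #|val i :\ u| == 2.
  by have := cardsD1 u (val i); rewrite ut triangle_card // add1n => -[<-].
case/cards2P => a [b [ab E]]; exists (a, b, u) => /=.
have /andP[au at_] : (a != u) && (a \in val i) by rewrite -in_setD1 E !inE eqxx.
have /andP[bu bt] : (b != u) && (b \in val i) by rewrite -in_setD1 E !inE eqxx orbT.
by split=> //; rewrite setUC -E setD1K.
Qed.

Variables (a b u : pendant -> V).
Hypothesis abuP : forall i,
  [/\ val i = [set a i; b i; u i], a i != b i, a i != u i, b i != u i & u i \notin C].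

(** The apex [u i] lies outside [C], hence in no other triangle. So [u] is injective, with values in
    [verts 1] minus [C]. *)
Lemma card_pendant : (#|{: pendant}| + #|C| <= #|verts 1|)%N.
Proof.
have uinj : injective u.
  move=> i j uij; apply: val_inj; apply: (@triangle_uniq _ _ (u i)); rewrite ?pendantT //.
  - by have [-> _ _ _ _] := abuP i; rewrite !inE eqxx orbT.
  - by have [-> _ _ _ _] := abuP j; rewrite uij !inE eqxx orbT.
  - by have [] := abuP i.
rewrite -cardsT -(card_imset _ uinj) -(cardsID C (verts 1)).
rewrite (setIidPr verts21) addnC leq_add2l subset_leq_card //.
apply/subsetP => _ /imsetP[i _ ->]; have [ti _ _ _ uC] := abuP i.
rewrite in_setD uC (subsetP (triangle_sub (pendantT i))) // ti.
by rewrite !inE eqxx orbT.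
Qed.

Variable X : V -> V -> R.
Hypothesis aX : antisym X.

Definition triQ := 6^-1 * \sum_x \sum_y \sum_w
  (if [set x; y; w] \in T then (X x y + X y w + X w x) ^+ 2 else 0).

Definition pend i := X (a i) (b i) + X (b i) (u i) + X (u i) (a i).

(** Squared norm of [X] on the edges of triangle [i] that are not inside [C]: two edges in the core
    case, three otherwise. *)
Definition pendn i := X (b i) (u i) ^+ 2 + X (u i) (a i) ^+ 2
  + (if core C a b i then 0 else X (a i) (b i) ^+ 2).

Lemma triQ_le_verts1 : triQ <= curln (verts 1) X.
Proof.
rewrite ler_pM2l ?invr_gt0 ?ltr0n //.
rewrite [leRHS]big_mkcond; apply: ler_sum => x _.
case: ifP => xD; last first.
  apply: sumr_le0 => y _; apply: sumr_le0 => w _; case: ifP => // /triangle_sub.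
  by move/subsetP/(_ x); rewrite xD !inE eqxx => /(_ isT).
rewrite [leRHS]big_mkcond; apply: ler_sum => y _.
case: ifP => yD; last first.
  apply: sumr_le0 => w _; case: ifP => // /triangle_sub.
  by move/subsetP/(_ y); rewrite yD !inE eqxx orbT => /(_ isT).
rewrite [leRHS]big_mkcond; apply: ler_sum => w _.
case: ifP => tT; case: ifP => wD //; last exact: sqr_ge0.
by move: tT => /triangle_sub/subsetP/(_ w); rewrite wD !inE eqxx orbT => /(_ isT).
Qed.

(** A triangle is either contained in [C], hence counted in the complete complex on [C], or
    pendant. *)
Lemma triQ_le : triQ <= curln C X + sqn pend.
Proof.
pose s (p : V * V * V) := (X p.1.1 p.1.2 + X p.1.2 p.2 + X p.2 p.1.1) ^+ 2.
pose st (p : V * V * V) := [set p.1.1; p.1.2; p.2].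
have s0 p : 0 <= s p by apply: sqr_ge0.
have -> : triQ = 6^-1 * \sum_(p | st p \in T) s p.
  by rewrite /triQ pair_bigA pair_bigA [in RHS]big_mkcond.
have -> : curln C X = 6^-1 * \sum_(p | st p \subset C) s p.
  rewrite /curln; congr (_ * _).
  rewrite pair_big pair_big /=; apply: eq_bigl => -[[x y] w] /=.
  by rewrite /st /= !subUset !sub1set.
(* Only the six orderings of a triangle span it, and antisymmetry gives them all the same square. *)
have pe i : \sum_(p | st p == val i) s p <= 6 * pend i ^+ 2.
  have [ti abi aui bui _] := abuP i.
  pose l := [:: (a i, b i, u i); (a i, u i, b i); (b i, a i, u i);
                (b i, u i, a i); (u i, a i, b i); (u i, b i, a i)].
  have lu : uniq l.
    rewrite /= !inE !xpair_eqE !eqxx (eq_sym (b i) (a i)) (eq_sym (u i) (a i)).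
    by rewrite (eq_sym (u i) (b i)) (negPf abi) (negPf aui) (negPf bui) /= ?andbF.
  apply: le_trans (sum_seq_ge lu s0 _) _.
    move=> [[x y] w] /eqP; rewrite /st ti /= => E.
    have c3 : #|[set x; y; w]| = 3 by rewrite E -ti triangle_card ?pendantT.
    have xy : x != y.
      by apply: contra_eqN c3 => /eqP->; rewrite setUid cards2; case: (y != w).
    have xw : x != w.
      by apply: contra_eqN c3 => /eqP->; rewrite setUAC setUid cards2; case: (w != y).
    have yw : y != w.
      by apply: contra_eqN c3 => /eqP->; rewrite -setUA setUid cards2; case: (x != w).
    have : x \in [set x; y; w] by rewrite !inE eqxx.
    have : y \in [set x; y; w] by rewrite !inE eqxx orbT.
    have : w \in [set x; y; w] by rewrite !inE eqxx orbT.
    rewrite E !inE -!orbA => /or3P[] /eqP ww /or3P[] /eqP yy /or3P[] /eqP xx;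
      move: xy xw yw; rewrite ww yy xx ?eqxx //= => _ _ _;
      by rewrite !xpair_eqE !eqxx /= ?orbT.
  rewrite /l !big_cons big_nil /s /pend /= (aX (b i) (a i)) (aX (u i) (b i)).
  by rewrite (aX (a i) (u i)) le_eqVlt; apply/orP; left; apply/eqP; ring.
have split3 : \sum_(p | st p \in T) s p
    <= \sum_(p | st p \subset C) s p + \sum_(i : pendant) \sum_(p | st p == val i) s p.
  have -> : \sum_(i : pendant) \sum_(p | st p == val i) s p
      = \sum_p \sum_(i : pendant | st p == val i) s p.
    by under eq_bigr => i _ do rewrite big_mkcond; rewrite exchange_big;
      apply: eq_bigr => p _; rewrite -big_mkcond.
  rewrite big_mkcond [\sum_(p | st p \subset C) _]big_mkcond -big_split.
  apply: ler_sum => p _ /=.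
  have r0 : 0 <= \sum_(i : pendant | st p == val i) s p by apply: sumr_ge0.
  case: ifP => tT; case: ifP => tC; rewrite ?add0r ?addr_ge0 ?lerDl //.
  have pt : (st p \in T) && ~~ (st p \subset C) by rewrite tT tC.
  by rewrite (bigD1 (exist _ (st p) pt : pendant)) //= lerDl sumr_ge0.
have : \sum_(i : pendant) \sum_(p | st p == val i) s p <= \sum_i 6 * pend i ^+ 2.
  by apply: ler_sum => i _; apply: pe.
rewrite -mulr_sumr -/(sqn pend) => le6.
rewrite -(ler_pM2l (ltr0n R 6)) mulrDr !mulVKf ?pnatr_eq0 //.
by apply: le_trans split3 _; rewrite lerD2l.
Qed.

(** The edges counted are disjoint: those of [pendn] have an end outside [C], and such an end
    determines the triangle. *)
Lemma nrm_ge : nrm C X + \sum_i pendn i <= nrm [set: V] X.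
Proof.
pose s (p : V * V) := X p.1 p.2 ^+ 2.
have s0 p : 0 <= s p by apply: sqr_ge0.
have -> : nrm [set: V] X = 2^-1 * \sum_p s p.
  rewrite /nrm pair_big; congr (_ * _); apply: eq_bigl => p.
  by rewrite !inE.
pose inC (p : V * V) := (p.1 \in C) && (p.2 \in C).
have -> : nrm C X = 2^-1 * \sum_(p | inC p) s p by rewrite /nrm pair_big.
pose E (i : pendant) (p : V * V) := [&& p.1 \in val i, p.2 \in val i & ~~ inC p].
have pe i : 2 * pendn i <= \sum_(p | E i p) s p.
  have [ti abi aui bui uC] := abuP i.
  have ai : a i \in val i by rewrite ti !inE eqxx.
  have bi : b i \in val i by rewrite ti !inE eqxx orbT.
  have ui : u i \in val i by rewrite ti !inE eqxx orbT.
  pose l := [:: (b i, u i); (u i, b i); (u i, a i); (a i, u i)]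
    ++ (if core C a b i then [::] else [:: (a i, b i); (b i, a i)]).
  have lu : uniq l.
    rewrite /l; case: ifP => _; rewrite /= !inE !xpair_eqE !eqxx;
      rewrite (eq_sym (b i) (a i)) (eq_sym (u i) (a i)) (eq_sym (u i) (b i));
      by rewrite (negPf abi) (negPf aui) (negPf bui) /= ?andbF.
  apply: le_trans (sum_uniq_le lu s0 _).
    rewrite /l /pendn /s big_cat /= !big_cons big_nil /= (aX (u i) (b i)).
    rewrite (aX (a i) (u i)); case: ifP => _; rewrite ?big_cons big_nil /=.
      by rewrite le_eqVlt; apply/orP; left; apply/eqP; ring.
    rewrite (aX (b i) (a i)).
    by rewrite le_eqVlt; apply/orP; left; apply/eqP; ring.
  move=> p; rewrite /l mem_cat !inE -!orbA => /or4P[/eqP->|/eqP->|/eqP->|].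
  - by rewrite /E /inC /= bi ui (negPf uC) andbF.
  - by rewrite /E /inC /= bi ui (negPf uC).
  - by rewrite /E /inC /= ai ui (negPf uC).
  case/orP => [/eqP->|]; first by rewrite /E /inC /= ai ui (negPf uC) andbF.
  case: ifP => // ci; rewrite !inE => /orP[] /eqP->; rewrite /E /inC /= ai bi.
    by move: ci; rewrite /core => ->.
  by move: ci; rewrite /core andbC => ->.
have disj : \sum_(p | inC p) s p + \sum_i \sum_(p | E i p) s p <= \sum_p s p.
  have -> : \sum_i \sum_(p | E i p) s p = \sum_p \sum_(i | E i p) s p.
    by under eq_bigr => i _ do rewrite big_mkcond; rewrite exchange_big;
      apply: eq_bigr => p _; rewrite -big_mkcond.
  rewrite [\sum_(p | inC p) _]big_mkcond -big_split; apply: ler_sum => p _ /=.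
  case: ifP => pC.
    by rewrite big1 ?addr0 // => i; rewrite /E pC !andbF.
  rewrite add0r; case: (pickP (E ^~ p)) => [i Ei|E0]; last by rewrite big_pred0.
  rewrite (big_pred1 i) // => j; apply/idP/eqP => [Ej|-> //].
  move: Ei Ej; rewrite /E pC andbT => /andP[i1 i2] /and3P[j1 j2 _].
  move: pC => /negbT; rewrite negb_and => /orP[] pC; apply: val_inj.
    exact: (triangle_uniq (pendantT j) (pendantT i) j1 i1 pC).
  exact: (triangle_uniq (pendantT j) (pendantT i) j2 i2 pC).
have : \sum_i 2 * pendn i <= \sum_i \sum_(p | E i p) s p.
  by apply: ler_sum => i _; apply: pe.
rewrite -mulr_sumr => le2.
rewrite -(ler_pM2l (ltr0n R 2)) mulrDr !mulVKf ?pnatr_eq0 //.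
by apply: le_trans disj; rewrite lerD2l.
Qed.

Lemma pendn_core i : core C a b i -> (pend i - X (a i) (b i)) ^+ 2 <= 2 * pendn i.
Proof.
rewrite /pend /pendn => ->; have := sqr_ge0 (X (b i) (u i) - X (u i) (a i)).
by nra.
Qed.

Lemma pendn_sqr i : ~~ core C a b i -> pend i ^+ 2 <= 3 * pendn i.
Proof.
rewrite /pend /pendn => /negPf->; have := sqr_ge0 (X (b i) (u i) - X (u i) (a i)).
have := sqr_ge0 (X (a i) (b i) - X (u i) (a i)).
have := sqr_ge0 (X (a i) (b i) - X (b i) (u i)).
by nra.
Qed.

(** If the curl vanishes on the pendant triangles, only the complete complex on [C] remains, and its
    form is at most [#|C|] times the norm. This gives injectivity of [pend] on the eigenplane. *)
Lemma triQ_lt (c : R) : #|C|%:R < c -> 0 < nrm [set: V] X ->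
  (forall i, pend i = 0) -> triQ < c * nrm [set: V] X.
Proof.
move=> hc N0 z0; apply: (@le_lt_trans _ _ (#|C|%:R * nrm [set: V] X)); last first.
  by rewrite ltr_pM2r.
apply: le_trans triQ_le _; rewrite /sqn big1 ?addr0 => [|i _]; last by rewrite z0 expr0n.
rewrite curlnE //; apply: (@le_trans _ _ (#|C|%:R * nrm C X)).
  by rewrite gerBl divn_ge0.
rewrite ler_wpM2l // ?ler0n //; apply: le_trans nrm_ge; rewrite lerDl.
apply: sumr_ge0 => i _; rewrite /pendn; case: ifP => _; nra.
Qed.

End Pendant.

(** * Two orthogonal eigenflows *)

Section Assembly.
Variables (R : realType) (V : finType) (e : rel V).
Hypothesis e_sym : symmetric e.
Local Notation flow := (subvs_of (L2E R e)).
Local Notation L := (curl_adj_curl R e).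
Local Notation C := (verts e 2).
Local Notation N X := (edge_dot X X).

Definition flowf (X : flow) u v : R := vsval X (u, v).

Lemma flowf_antisym X : antisym (flowf X).
Proof.
move=> u v; have /edge_flowP E := subvsP X; have := E u v; have := E v u.
by rewrite /flowf e_sym; case: ifP => // _ -> ->; rewrite oppr0.
Qed.

Lemma flowfE s t X Y u v :
  flowf (s *: X + t *: Y) u v = s * flowf X u v + t * flowf Y u v.
Proof. by rewrite /flowf !ffunE. Qed.

Lemma edge_dotC (X Y : flow) : edge_dot X Y = edge_dot Y X.
Proof.
by congr (_ * _); apply: eq_bigr => u _; apply: eq_bigr => v _; rewrite mulrC.
Qed.

Lemma edge_dotDZ k (X Y Z : flow) :
  edge_dot (k *: X + Y) Z = k * edge_dot X Z + edge_dot Y Z.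
Proof.
rewrite /edge_dot mulrCA -mulrDr; congr (_ * _).
rewrite mulr_sumr -big_split; apply: eq_bigr => u _ /=.
rewrite mulr_sumr -big_split; apply: eq_bigr => v _ /=.
by rewrite !ffunE mulrDl mulrA.
Qed.

Lemma edge_dot_nrm (X : flow) : N X = nrm [set: V] (flowf X).
Proof.
congr (_ * _); apply: eq_big => [u|u _]; first by rewrite inE.
by apply: eq_big => [v|v _]; rewrite ?inE // expr2.
Qed.

Lemma edge_dot_gt0 (X : flow) : X != 0 -> 0 < N X.
Proof.
move=> X0; rewrite lt0r edge_dot_nrm nrm_ge0 andbT.
apply: contraNneq X0 => /nrm0 F0; apply/eqP/val_inj/ffunP => -[u v].
by have := F0 u v; rewrite !inE ffunE => /(_ isT isT).
Qed.

Lemma curl_adj_curl_adj (X Y : flow) : edge_dot (L X) Y = edge_dot X (L Y).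
Proof.
rewrite edge_dotC !curl_adj_curlE -!curl_adjP /tri_dot; congr (_ * _).
apply: eq_bigr => u _; apply: eq_bigr => v _; apply: eq_bigr => w _.
by rewrite mulrC.
Qed.

Lemma edge_dot_triQ (X : flow) : edge_dot (L X) X = triQ e (flowf X).
Proof.
rewrite edge_dotC curl_adj_curlE -curl_adjP; congr (_ * _).
apply: eq_bigr => u _; apply: eq_bigr => v _; apply: eq_bigr => w _.
by rewrite /= ffunE; case: ifP => _; rewrite ?mulr0 // expr2.
Qed.

Lemma triQ_eigen l (X : flow) : L X = l *: X -> triQ e (flowf X) = l * N X.
Proof.
by move=> E; rewrite -edge_dot_triQ E (innerZl edge_dotDZ).
Qed.

(** All triangles lie in the complete complex on [verts 1], whose eigenvalues are at most its number
    of vertices by [curlnE]. *)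
Lemma eigenvalue_le_verts l (X : flow) :
  X != 0 -> L X = l *: X -> l <= #|verts e 1|%:R.
Proof.
move=> X0 /triQ_eigen E; rewrite -(ler_pM2r (edge_dot_gt0 X0)) -E.
apply: le_trans (triQ_le_verts1 e (flowf X)) _.
rewrite curlnE; last exact: flowf_antisym.
apply: (@le_trans _ _ (#|verts e 1|%:R * nrm (verts e 1) (flowf X))).
  by rewrite gerBl divn_ge0.
rewrite ler_wpM2l ?ler0n // edge_dot_nrm; exact: nrm_leT.
Qed.

(** * The eigenplane seen on the pendant triangles *)

Section TwoEigenvectors.
Variables (a b u : pendant e -> V).
Hypothesis abuP : forall i,
  [/\ val i = [set a i; b i; u i], a i != b i, a i != u i, b i != u i & u i \notin C].
Variables (l1 l2 : R) (X1 X2 : flow).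
Hypotheses (l21 : l2 <= l1) (hl2 : #|C|%:R < l2).
Hypotheses (X10 : X1 != 0) (X20 : X2 != 0) (X12 : edge_dot X1 X2 = 0).
Hypotheses (LX1 : L X1 = l1 *: X1) (LX2 : L X2 = l2 *: X2).

Let z X := pend a b u (flowf X).
Let comb s t : flow := s *: X1 + t *: X2.

Lemma pend_comb s t i : z (comb s t) i = s * z X1 i + t * z X2 i.
Proof. by rewrite /z /pend !flowfE; ring. Qed.

Lemma comb_dot s t :
  N (comb s t) = s ^+ 2 * N X1 + t ^+ 2 * N X2 /\
  triQ e (flowf (comb s t)) = s ^+ 2 * (l1 * N X1) + t ^+ 2 * (l2 * N X2).
Proof.
have Z (k : R) (X Y : flow) : edge_dot (k *: X) Y = k * edge_dot X Y.
  exact: (innerZl edge_dotDZ).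
have E p q : edge_dot (comb p q) (comb s t) = p * s * N X1 + q * t * N X2.
  rewrite /comb edge_dotDZ Z (edge_dotC X1) (edge_dotC X2) !edge_dotDZ !Z.
  by rewrite (edge_dotC X2 X1) X12; ring.
split; first by rewrite E; ring.
rewrite -edge_dot_triQ linearD !linearZ /= LX1 LX2 !scalerA E; ring.
Qed.

Lemma comb_ge s t : l2 * N (comb s t) <= triQ e (flowf (comb s t)).
Proof.
have [-> ->] := comb_dot s t; rewrite mulrDr [l2 * (t ^+ 2 * _)]mulrCA lerD2r.
rewrite mulrCA; apply: ler_wpM2l; first exact: sqr_ge0.
by apply: ler_wpM2r l21; apply: ltW; apply: edge_dot_gt0.
Qed.

Lemma comb_gt0 s t : (s != 0) || (t != 0) -> 0 < N (comb s t).
Proof.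
have [-> _] := comb_dot s t; have N1 := edge_dot_gt0 X10; have N2 := edge_dot_gt0 X20.
case/orP => h0; [apply: ltr_pwDl | apply: ltr_wpDl].
- by apply: mulr_gt0 N1; rewrite lt0r sqrf_eq0 h0 sqr_ge0.
- by apply: mulr_ge0 (ltW N2); rewrite sqr_ge0.
- by apply: mulr_ge0 (ltW N1); rewrite sqr_ge0.
- by apply: mulr_gt0 N2; rewrite lt0r sqrf_eq0 h0 sqr_ge0.
Qed.

(** A nonzero combination has Rayleigh quotient at least [l2], but by [triQ_lt] the quotient would
    be below [l2] if its curl vanished on every pendant triangle. *)
Lemma comb_sqn s t : (s != 0) || (t != 0) ->
  0 < sqn (fun i => s * z X1 i + t * z X2 i).
Proof.
move=> st; rewrite lt0r sqn_ge0 andbT; apply/eqP => /psumr_eq0P z0.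
have := comb_ge s t; rewrite leNgt => /negP; apply.
have N0 := comb_gt0 st; rewrite edge_dot_nrm in N0 *.
apply: (triQ_lt abuP (flowf_antisym _) hl2 N0) => i.
rewrite -/(z _ i) pend_comb; apply/eqP; rewrite -sqrf_eq0; apply/eqP.
by apply: z0 => // j _; apply: sqr_ge0.
Qed.

(** The left side of [rayleigh_bound] is nonnegative here and its prefactor is positive, so the
    other factor is nonnegative. *)
Lemma triQ_penf c (X : flow) (y : pendant e -> R) : (1 < #|C|)%N -> #|C|%:R < c ->
  (forall i, y i = z X i) -> c * N X <= triQ e (flowf X) ->
  (c - #|C|%:R) * sqn y <= penf C a b c y.
Proof.
move=> C1 hc yE le; have h2 : 2 <= #|C|%:R :> R by rewrite ler_nat.
have aX := flowf_antisym X.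
have ab i : a i != b i by have [] := abuP i.
have sE : sqn y = sqn (z X) by apply: eq_bigr => i _; rewrite yE.
have H : triQ e (flowf X) - c * N X <=
    (c - 2) / (c * (c - #|C|%:R)) * (penf C a b c y - (c - #|C|%:R) * sqn y).
  apply: (rayleigh_bound (X := flowf X) (n := pendn a b u (flowf X))) => //.
  - by move=> i; rewrite yE; apply: pendn_core.
  - by move=> i; rewrite yE; apply: pendn_sqr.
  - by rewrite sE; apply: triQ_le.
  - by rewrite edge_dot_nrm; apply: nrm_ge.
have k0 : 0 < (c - 2) / (c * (c - #|C|%:R)).
  by apply: divr_gt0; [lra | apply: mulr_gt0; lra].
rewrite -subr_ge0 -(pmulr_rge0 _ k0); apply: le_trans H.
by rewrite subr_ge0.
Qed.

Lemma lambda_sum_core : (1 < #|C|)%N -> l1 + l2 <= (#|verts e 1| + #|C|)%:R.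
Proof.
move=> C1; have h2 : 2 <= #|C|%:R :> R by rewrite ler_nat.
have ab i : a i != b i by have [] := abuP i.
apply: (@le_trans _ _ (2 * #|C| + #|{: pendant e}|)%:R); last first.
  by rewrite ler_nat; have := card_pendant abuP; lia.
apply: (top_two_bound ab (z1 := z X1) (z2 := z X2)) => //.
- exact: comb_sqn.
- move=> s t; apply: (@triQ_penf _ (comb s t)) => // [i|]; last exact: comb_ge.
  by rewrite pend_comb.
- apply: (@triQ_penf _ X1) => //; first exact: lt_le_trans l21.
  by rewrite (triQ_eigen LX1).
Qed.

(** By [comb_sqn] the eigenplane embeds into functions on pendant triangles, so that space has
    dimension at least 2. *)
Lemma pendant_card_gt1 : (1 < #|{: pendant e}|)%N.
Proof.
rewrite ltnNge; apply/negP => /card_le1_eqP le1.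
have [i _|I0] := pickP (@predT (pendant e)); last first.
  have := @comb_sqn 1 0; rewrite oner_eq0 => /(_ isT).
  by rewrite /sqn big_pred0 // ltxx.
have E f : sqn f = f i ^+ 2 :> R.
  by rewrite /sqn (big_pred1 i) // => j; apply/esym/eqP/le1.
have pos := comb_sqn; pose p := z X1 i; pose q := z X2 i.
have [pq|] := boolP ((q != 0) || (- p != 0)).
  have := pos _ _ pq; rewrite E -/p -/q (_ : q * p + - p * q = 0); last by ring.
  by rewrite expr0n ltxx.
rewrite negb_or !negbK oppr_eq0 => /andP[_ /eqP p0].
have := pos 1 0; rewrite oner_eq0 E -/p p0 mulr0 mul0r addr0 => /(_ isT).
by rewrite expr0n ltxx.
Qed.

(** With [#|C| <= 1] no pendant triangle has an edge inside [C], so each one has three private edges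
    and Cauchy-Schwarz gives the factor 3. *)
Lemma triQ_le3 (X : flow) : (#|C| <= 1)%N -> triQ e (flowf X) <= 3 * N X.
Proof.
move=> C1; have aX := flowf_antisym X.
have nc i : ~~ core C a b i.
  apply/negP => /andP[aC bC]; have [_ /eqP abi _ _ _] := abuP i; apply: abi.
  by move/card_le1_eqP: C1; apply.
have := triQ_le abuP aX; have := nrm_ge abuP aX; rewrite -edge_dot_nrm => Nge Qle.
have C1' : #|C|%:R <= 1 :> R by rewrite (ler_nat _ _ 1).
have n0 := nrm_ge0 C (flowf X); have d0 := divn_ge0 C (flowf X).
rewrite curlnE // in Qle.
have zle : sqn (pend a b u (flowf X)) <= 3 * \sum_i pendn a b u (flowf X) i.
  by rewrite mulr_sumr; apply: ler_sum => i _; apply: pendn_sqr.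
have := ler_wpM2r n0 C1'; lra.
Qed.

(** Two distinct pendant triangles have 6 vertices counted with multiplicity; their union lies in
    [verts 1] and their intersection in [C]. *)
Lemma verts_ge6 : (6 <= #|verts e 1| + #|C|)%N.
Proof.
have /card_gt1P[i [j [_ _ ij]]] := pendant_card_gt1.
have [iT jT] := (pendantT i, pendantT j).
have := cardsUI (val i) (val j); rewrite (triangle_card iT) (triangle_card jT) => E6.
apply: (@leq_trans (3 + 3)%N) => //; rewrite -E6.
apply: leq_add; apply: subset_leq_card.
  by rewrite subUset !triangle_sub.
apply/subsetP => v /setIP[vi vj]; apply: contraNT ij => vC.
by apply/eqP/val_inj/(triangle_uniq iT jT vi vj vC).
Qed.

Lemma lambda_sum_eigen : l1 + l2 <= (#|verts e 1| + #|C|)%:R.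
Proof.
have [C1|C1] := ltnP 1 #|C|; first exact: lambda_sum_core.
have le3 l X : X != 0 -> L X = l *: X -> l <= 3.
  move=> X0 /triQ_eigen E; rewrite -(ler_pM2r (edge_dot_gt0 X0)) -E.
  exact: triQ_le3.
(* With at most one vertex in [C], both eigenvalues are at most 3, and the counting bound 6
   suffices. *)
apply: (@le_trans _ _ 6%:R); last by rewrite ler_nat verts_ge6.
by have := le3 _ _ X10 LX1; have := le3 _ _ X20 LX2; lra.
Qed.

End TwoEigenvectors.

End Assembly.

Theorem theorem1 (R : realType) (V : finType) (e : rel V)
    (e_sym : symmetric e) (e_irr : irreflexive e) :
  lambda 1 (curl_adj_curl R e) + lambda 2 (curl_adj_curl R e)
    <= (Dtop e 1 + Dtop e 2)%:R.
Proof.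
set L := curl_adj_curl R e.
have dg := @edge_dot_gt0 R V e; have dC := @edge_dotC R V e.
have dD := @edge_dotDZ R V e; have dA := @curl_adj_curl_adj R V e.
have l1n : lambda 1 L <= (Dtop e 1)%:R.
  case: (lambda1_eigenvector L) => [->|[X X0 LX]]; first by rewrite ler0n.
  exact: eigenvalue_le_verts LX.
(* If [lambda 2 L] is at most the second count, the two bounds simply add up. *)
have [l2h|hl2] := leP (lambda 2 L) (Dtop e 2)%:R.
  by rewrite natrD lerD.
(* Now [lambda 2 L] exceeds a natural number, so it is not the default value 0 and comes from a
   genuine eigenvector. *)
case: (lambda2_eigenvectors dD dC dg dA) => [l20|].
  by move: hl2; rewrite l20 ltrn0.
case=> l21 [X1 [X2 [X10 X20 X12 LX1 LX2]]].
have [a [b [u abuP]]] := pendant_choice e.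
exact: (lambda_sum_eigen e_sym abuP l21 hl2 X10 X20 X12 LX1 LX2).
Qed.
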